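(* Let $p\ge 1$ be an integer and let $F$ be a polyharmonic ($p$-harmonic) mapping in the unit disk $\mathbb{D}$ of the form $$F(z)=a_{0}+\sum_{k=1}^{p}|z|^{2(k-1)}\big(h_{k}(z)+\overline{g_{k}(z)}\big)=a_{0}+\sum_{k=1}^{p}|z|^{2(k-1)}\sum_{n=1}^{\infty}\big(a_{n,k}z^{n}+\overline{b_{n,k}}\,\overline{z}^{n}\big),$$ where $h_k(z)=\sum_{n\ge1}a_{n,k}z^n$ and $g_k(z)=\sum_{n\ge 1}b_{n,k}z^n$ are analytic in $\mathbb{D}$. Suppose that for all $n\ge1$ and $k_1,k_2,k_3,k_4\in\{1,\dots,p\}$, all non-zero coefficients $a_{n,k_{1}},a_{n,k_{2}}$ and $b_{n,k_{3}},b_{n,k_{4}}$ satisfy $$\left|\arg \frac{a_{n,k_{1}}}{a_{n,k_{2}}}\right|\leq\frac{\pi}{2}\quad\text{and}\quad\left|\arg \frac{b_{n,k_{3}}}{b_{n,k_{4}}}\right|\leq\frac{\pi}{2}.$$ Let $L(F)=zF_z-\overline zF_{\overline z}$. If $|F(z)|\leq M$ in $\mathbb{D}$ for some $M>1$ and $F(0)=|J_{F}(0)|-1=0$, then $L(F)$ is univalent in the disk $\mathbb{D}_{r_{6}}$ and $L(F)(\mathbb{D}_{r_{6}})$ contains a univalent disk $\mathbb{D}_{\rho_{6}}$, where $r_{6}=r_6(M,p)$ is the least positive root of the equation $$1-\sqrt{M^{4}-1}\left(\frac{2r-r^{2}}{(1-r)^{2}}+\sum_{k=1}^{p}\frac{2r^{2k-1}}{(1-r)^{3}}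 +\sum_{k=2}^{p}\frac{(2k-1)r^{2(k-1)}}{(1-r)^{2}} \right)=0,$$ and $$\rho_{6}=\lambda_{0}(M)r_{6}\left(1-\sqrt{M^{4}-1}\,\frac{2r_{6}-r_{6}^{2}}{(1-r_{6})^{2}}-\sqrt{M^{4}-1}\sum_{k=2}^{p}\frac{r_{6}^{2(k-1)}}{(1-r_{6})^{2}}\right),\qquad \lambda_{0}(M)=\frac{\sqrt{2}}{\sqrt{M^{2}-1}+\sqrt{M^{2}+1}}.$$ In particular, if $|F(z)|\leq 1$ for all $z\in \mathbb{D}$ and $F(0)=|J_{F}(0)|-1=0$, then $L(F)$ is univalent and maps $\mathbb{D}$ onto $\mathbb{D}$.
   Context: $\mathbb{D}_r=\{z\in\mathbb{C}:|z|<r\}$ and $\mathbb{D}=\mathbb{D}_1$. A $2p$ times continuously differentiable complex-valued mapping $F$ in a domain is polyharmonic (or $p$-harmonic), $p\ge1$, if $\Delta^pF=0$, where $\Delta=4\,\partial^2/\partial z\partial\overline z$ is the Laplacian and $\Delta^pF=\Delta(\Delta^{p-1}F)$. The argument $\arg$ is the principal value in $(-\pi,\pi]$. The Jacobian is $J_F(z)=|F_z(z)|^2-|F_{\overline z}(z)|^2$. Univalent means injective. For a mapping $H$, the image $H(\mathbb{D}_{r})$ contains a univalent disk $\mathbb{D}_{\rho}$ if $H$ maps some subdomain of $\mathbb{D}_r$ injectively onto $\mathbb{D}_\rho$. Empty sums are $0$. *)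

(* Defs.v *)
From Stdlib Require Import Reals Lra Lia.
From Coquelicot Require Import Coquelicot.
Open Scope R_scope.

Definition disk (r : R) (z : C) : Prop := Cmod z < r.

Definition connected_set (U : C -> Prop) : Prop :=
  forall V W : C -> Prop, open V -> open W ->
    (forall z, U z -> V z \/ W z) ->
    (exists z, U z /\ V z) -> (exists z, U z /\ W z) ->
    exists z, U z /\ V z /\ W z.

Definition domain (U : C -> Prop) : Prop :=
  open U /\ connected_set U /\ (exists z, U z).

Definition univalent_on (U : C -> Prop) (H : C -> C) : Prop :=
  forall z w, U z -> U w -> H z = H w -> z = w.

(* H(U) = V. *)
Definition maps_onto (H : C -> C) (U V : C -> Prop) : Prop :=
  forall w, V w <-> exists z, U z /\ H z = w.

(* Since [domain] requires non-emptiness, this also forces [0 < rho]. *)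
Definition contains_univalent_disk (H : C -> C) (r rho : R) : Prop :=
  exists U : C -> Prop,
    domain U /\ (forall z, U z -> disk r z) /\
    univalent_on U H /\ maps_onto H U (disk rho).

(* Principal argument, in (-PI, PI] (see [Carg_spec]); junk value at 0. *)
Definition Carg (z : C) : R :=
  if Rle_dec 0 (Im z) then acos (Re z / Cmod z) else - acos (Re z / Cmod z).

(* Partial derivatives in z = x + i y. They are total; the value is meaningful
   where [ex_partials] holds. *)
Definition partial_x (F : C -> C) (z : C) : C :=
  (Derive (fun t => Re (F (t, Im z))) (Re z),
   Derive (fun t => Im (F (t, Im z))) (Re z)).

Definition partial_y (F : C -> C) (z : C) : C :=
  (Derive (fun t => Re (F (Re z, t))) (Im z),
   Derive (fun t => Im (F (Re z, t))) (Im z)).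

Definition ex_partials (F : C -> C) (z : C) : Prop :=
  ex_derive (fun t => Re (F (t, Im z))) (Re z) /\
  ex_derive (fun t => Im (F (t, Im z))) (Re z) /\
  ex_derive (fun t => Re (F (Re z, t))) (Im z) /\
  ex_derive (fun t => Im (F (Re z, t))) (Im z).

(* [F] is [m] times continuously (real-)differentiable in the open set [U]. *)
Fixpoint continuously_diff (m : nat) (U : C -> Prop) (F : C -> C) : Prop :=
  (forall z, U z -> continuous F z) /\
  match m with
  | O => True
  | S m' =>
      (forall z, U z -> ex_partials F z) /\
      continuously_diff m' U (partial_x F) /\
      continuously_diff m' U (partial_y F)
  end.

(* Wirtinger derivatives F_z and F_{\bar z}. *)
Definition d_z (F : C -> C) (z : C) : C :=
  ((partial_x F z - Ci * partial_y F z) / 2)%C.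

Definition d_zbar (F : C -> C) (z : C) : C :=
  ((partial_x F z + Ci * partial_y F z) / 2)%C.

Definition laplacian (F : C -> C) (z : C) : C :=
  (4 * d_z (d_zbar F) z)%C.

Definition polyharmonic (p : nat) (U : C -> Prop) (F : C -> C) : Prop :=
  continuously_diff (2 * p) U F /\
  (forall z, U z -> Nat.iter p laplacian F z = 0%C).

Definition jacobian (F : C -> C) (z : C) : R :=
  Cmod (d_z F z) ^ 2 - Cmod (d_zbar F z) ^ 2.

Definition L_op (F : C -> C) (z : C) : C :=
  (z * d_z F z - Cconj z * d_zbar F z)%C.

Definition lambda0 (M : R) : R :=
  sqrt 2 / (sqrt (M ^ 2 - 1) + sqrt (M ^ 2 + 1)).

Definition r6_fun (M : R) (p : nat) (r : R) : R :=
  1 - sqrt (M ^ 4 - 1) *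
    ((2 * r - r ^ 2) / (1 - r) ^ 2
     + sum_n_m (fun k : nat => 2 * r ^ (2 * k - 1) / (1 - r) ^ 3) 1 p
     + sum_n_m (fun k : nat =>
         INR (2 * k - 1) * r ^ (2 * (k - 1)) / (1 - r) ^ 2) 2 p).

Definition rho6_val (M : R) (p : nat) (r : R) : R :=
  lambda0 M * r *
    (1 - sqrt (M ^ 4 - 1) * ((2 * r - r ^ 2) / (1 - r) ^ 2)
       - sqrt (M ^ 4 - 1) *
         sum_n_m (fun k : nat => r ^ (2 * (k - 1)) / (1 - r) ^ 2) 2 p).

(* The equations considered have a denominator vanishing at [r = 1]. *)
Definition positive_root (f : R -> R) (r : R) : Prop :=
  0 < r /\ r <> 1 /\ f r = 0.

Definition least_positive_root (f : R -> R) (r : R) : Prop :=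
  positive_root f r /\ (forall s, positive_root f s -> r <= s).

Lemma Carg_spec (z : C) : z <> 0%C ->
  - PI < Carg z <= PI /\
  z = (Cmod z * cos (Carg z), Cmod z * sin (Carg z)).
Proof.
intros Hz.
assert (Hm : 0 < Cmod z) by (apply Cmod_gt_0; exact Hz).
assert (Hsq : Cmod z * Cmod z = Re z * Re z + Im z * Im z).
{ unfold Cmod. rewrite sqrt_sqrt.
  - unfold Re, Im; simpl; ring.
  - nra. }
assert (Hc : -1 <= Re z / Cmod z <= 1).
{ split.
  - apply Rmult_le_reg_r with (Cmod z); [exact Hm|].
    replace (Re z / Cmod z * Cmod z) with (Re z) by (field; lra). nra.
  - apply Rmult_le_reg_r with (Cmod z); [exact Hm|].
    replace (Re z / Cmod z * Cmod z) with (Re z) by (field; lra). nra. }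
pose proof (acos_bound (Re z / Cmod z)) as Hb.
pose proof PI_RGT_0 as Hpi.
assert (Hs : Cmod z * sin (acos (Re z / Cmod z)) = Rabs (Im z)).
{ rewrite sin_acos by exact Hc.
  rewrite <- (sqrt_Rsqr (Cmod z)) at 1 by lra.
  rewrite <- sqrt_mult_alt by apply Rle_0_sqr.
  rewrite <- sqrt_Rsqr_abs. f_equal. unfold Rsqr.
  replace (Cmod z * Cmod z * (1 - Re z / Cmod z * (Re z / Cmod z)))
    with (Cmod z * Cmod z - Re z * Re z) by (field; lra).
  rewrite Hsq. ring. }
assert (Hre : Cmod z * cos (acos (Re z / Cmod z)) = Re z).
{ rewrite cos_acos by exact Hc. field. lra. }
unfold Carg. destruct (Rle_dec 0 (Im z)) as [Hi|Hi].
- split; [lra|]. rewrite Hre, Hs, Rabs_pos_eq by exact Hi.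
  apply surjective_pairing.
- rewrite cos_neg, sin_neg, Hre.
  rewrite Rabs_left in Hs by lra. split.
  + split; [|lra].
    destruct (Req_dec (acos (Re z / Cmod z)) PI) as [E|E]; [|lra].
    rewrite E, sin_PI in Hs. lra.
  + replace (Cmod z * - sin (acos (Re z / Cmod z))) with (Im z) by lra.
    apply surjective_pairing.
Qed.

(* Main.v *)
Require Import Defs.
From Stdlib Require Import Reals Lra Lia ClassicalEpsilon Ranalysis5.
From Coquelicot Require Import Coquelicot.
Open Scope R_scope.

(** The operator L kills functions of |z| and is a derivation, so it turns the
    expansion of F into the expansion with coefficients n a_{n,k} and
    - n b_{n,k}.  Write L(F) = Lambda + P, where
    Lambda z = a_{1,1} z - conj (b_{1,1} z) and P collects all other terms.
    With lambda = | |a_{1,1}| - |b_{1,1}| | one has |Lambda z| >= lambda |z|, and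
    everything follows once P is shown to be small against Lambda.

    _Size of the coefficients._  On a circle |z| = r, Parseval's identity bounds
    the sum over n of r^{2n} (|sum_k a_{n,k} r^{2(k-1)}|^2 + the same for b) by
    M^2.  As the coefficients of a given n make angles of at most pi/2 with each
    other, the square of the inner sum is at least the sum of the squares, and
    r -> 1 gives sum (|a_{n,k}|^2 + |b_{n,k}|^2) <= M^2
    ([coefficient_inequality]).  The Jacobian condition at 0 reads
    lambda (|a_{1,1}| + |b_{1,1}|) = 1; together with the previous bound it
    yields lambda >= lambda_0(M) and
    |a_{n,k}| + |b_{n,k}| <= sqrt (M^4 - 1) lambda for (n,k) <> (1,1)
    ([lambda0_le], [coefficient_le_lambda]).

    _Size of P._  The monomial |z|^{2j} z^n has Lipschitz constant
    (2j + n) r^{2j+n-1} on the closed disk of radius r.  Summing these constants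
    against n times the coefficient bound shows that P is
    sqrt (M^4 - 1) lambda phi(r)-Lipschitz there, where 1 - sqrt (M^4 - 1) phi is
    the function whose root is r_6, and similarly that |P z| is at most
    sqrt (M^4 - 1) lambda psi(r) |z|, where psi is the expression occurring in
    rho_6 ([nonlinear_part_bounds]).

    _Conclusion._  As phi increases strictly from 0 to infinity on [0,1), it takes
    the value 1 / sqrt (M^4 - 1) exactly once there, at r_6; for r < r_6 the map
    P is a strict contraction relative to Lambda.  Hence L(F) is injective on
    D_{r_6}, and the equation z = Lambda^{-1} (w - P z) is solved by the
    contraction principle whenever |w| < rho_6.  The inverse branch is locally
    Lipschitz, so the image of D_{rho_6} under it is the required domain
    ([perturbation_contains_disk]).

    For M = 1 the factor sqrt (M^4 - 1) vanishes: P = 0, lambda = 1, and L(F) is a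
    linear isometry. *)

(** * Moduli *)

Lemma Cmod_minus_sym (z w : C) : Cmod (z - w) = Cmod (w - z).
Proof. rewrite <- Cmod_opp. f_equal. ring. Qed.

Lemma Cmod_triangle_minus (z w : C) : Cmod (z - w) <= Cmod z + Cmod w.
Proof. unfold Cminus. rewrite <- (Cmod_opp w). apply Cmod_triangle. Qed.

Lemma Cmod_triangle_rev (z w : C) : Cmod z - Cmod w <= Cmod (z - w).
Proof.
pose proof (Cmod_triangle (z - w) w) as H.
replace (z - w + w)%C with z in H by ring. lra.
Qed.

Lemma Cmod_Im (z : C) : Rabs (Im z) <= Cmod z.
Proof. eapply Rle_trans; [apply Rmax_r | apply Rmax_Cmod]. Qed.

Lemma Cmod_le_Re_Im (z : C) : Cmod z <= Rabs (Re z) + Rabs (Im z).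
Proof.
replace z with (RtoC (Re z) + Ci * RtoC (Im z))%C at 1
  by (destruct z; unfold Ci, Re, Im; apply injective_projections; simpl; ring).
eapply Rle_trans; [apply Cmod_triangle|].
rewrite Cmod_mult, Cmod_Ci, !Cmod_R. lra.
Qed.

Lemma Cminus_eq_0 (z w : C) : Cmod (z - w) <= 0 -> z = w.
Proof.
intros H. assert (E : (z - w)%C = 0).
{ apply Cmod_eq_0. pose proof (Cmod_ge_0 (z - w)). lra. }
replace z with (z - w + w)%C by ring. rewrite E. ring.
Qed.

(** * Series of complex numbers *)

Lemma sum_n_Cmod_le (u : nat -> C) (b : nat -> R) (N : nat) :
  (forall n, (n <= N)%nat -> Cmod (u n) <= b n) ->
  Cmod (sum_n u N) <= sum_n b N.
Proof.
induction N as [|N IH]; intros H.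
- rewrite !sum_O. apply H. lia.
- rewrite !sum_Sn. eapply Rle_trans; [apply Cmod_triangle|].
  apply Rplus_le_compat; [apply IH; intros; apply H; lia | apply H; lia].
Qed.

Lemma filterlim_Cmod (s : nat -> C) (l : C) :
  filterlim s eventually (locally l) <->
  forall eps, 0 < eps -> exists N, forall n, (N <= n)%nat -> Cmod (s n - l) < eps.
Proof.
split.
- intros H eps He.
  assert (Hs : 0 < sqrt 2) by (apply sqrt_lt_R0; lra).
  assert (He' : 0 < eps / sqrt 2) by (apply Rdiv_lt_0_compat; lra).
  destruct (proj1 (filterlim_locally s l) H (mkposreal _ He')) as [N HN].
  exists N. intros n Hn. specialize (HN n Hn).
  apply C_NormedModule_mixin_compat2 in HN. simpl in HN.
  replace (sqrt 2 * (eps / sqrt 2)) with eps in HN by (field; lra). exact HN.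
- intros H. apply filterlim_locally. intros eps.
  destruct (H eps (cond_pos eps)) as [N HN]. exists N. intros n Hn.
  apply C_NormedModule_mixin_compat1. exact (HN n Hn).
Qed.

Lemma is_series_Cmod (u : nat -> C) (l : C) :
  is_series u l <->
  forall eps, 0 < eps ->
    exists N, forall n, (N <= n)%nat -> Cmod (sum_n u n - l) < eps.
Proof. apply filterlim_Cmod. Qed.

Lemma sum_n_Re (u : nat -> C) (N : nat) :
  Re (sum_n u N) = sum_n (fun n => Re (u n)) N.
Proof.
induction N as [|N IH]; [now rewrite !sum_O|].
rewrite !sum_Sn, <- IH. reflexivity.
Qed.

Lemma sum_n_Im (u : nat -> C) (N : nat) :
  Im (sum_n u N) = sum_n (fun n => Im (u n)) N.
Proof.
induction N as [|N IH]; [now rewrite !sum_O|].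
rewrite !sum_Sn, <- IH. reflexivity.
Qed.

Lemma is_series_Cconj (u : nat -> C) (l : C) :
  is_series u l -> is_series (fun n => Cconj (u n)) (Cconj l).
Proof.
rewrite !is_series_Cmod. intros H eps He.
destruct (H eps He) as [N HN]. exists N. intros n Hn.
assert (E : sum_n (fun n => Cconj (u n)) n = Cconj (sum_n u n)).
{ clear. induction n as [|n IH]; [now rewrite !sum_O|].
  rewrite !sum_Sn, IH. symmetry. apply Cplus_conj. }
rewrite E, <- Cminus_conj, Cmod_conj. now apply HN.
Qed.

(** Only bounded partial sums are asked of the majorant: the finite identities
    for sums of (n+1) r^n and (n+1)^2 r^n then suffice, and no limit of n^2 r^n
    is ever needed. *)
Lemma is_series_Cmod_le (u : nat -> C) (l : C) (b : nat -> R) (B : R) :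
  is_series u l -> (forall n, Cmod (u n) <= b n) ->
  (forall N, sum_n b N <= B) -> Cmod l <= B.
Proof.
intros Hu Hb HB. apply le_epsilon. intros eps He.
destruct (proj1 (is_series_Cmod u l) Hu eps He) as [N HN].
specialize (HN N (le_n _)).
pose proof (Cmod_triangle_rev l (sum_n u N)) as H1.
rewrite Cmod_minus_sym in H1.
pose proof (sum_n_Cmod_le u b N (fun n _ => Hb n)). specialize (HB N). lra.
Qed.

(** Taken componentwise, because [Series] sums real terms only. *)
Definition CSeries (u : nat -> C) : C :=
  (Series (fun n => Re (u n)), Series (fun n => Im (u n))).

Lemma ex_series_bounded (b : nat -> R) (B : R) :
  (forall n, 0 <= b n) -> (forall N, sum_n b N <= B) -> ex_series b.
Proof.
intros Hb HB.
destruct (ex_finite_lim_seq_incr (sum_n b) B) as [l Hl].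
- intros n. rewrite sum_Sn. specialize (Hb (S n)). unfold plus; simpl. lra.
- exact HB.
- exists l. exact Hl.
Qed.

Lemma CSeries_correct (u : nat -> C) (b : nat -> R) (B : R) :
  (forall n, Cmod (u n) <= b n) -> (forall N, sum_n b N <= B) ->
  is_series u (CSeries u).
Proof.
intros Hb HB.
assert (Hex : ex_series b).
{ apply (ex_series_bounded b B); [|exact HB]. intros n.
  eapply Rle_trans; [apply Cmod_ge_0 | apply Hb]. }
assert (HR : is_series (fun n => Re (u n)) (Re (CSeries u))).
{ apply (Series_correct (fun n => Re (u n))).
  apply (ex_series_le (fun n => Re (u n)) b); [|exact Hex]. intros n.
  eapply Rle_trans; [apply re_le_Cmod | apply Hb]. }
assert (HI : is_series (fun n => Im (u n)) (Im (CSeries u))).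
{ apply (Series_correct (fun n => Im (u n))).
  apply (ex_series_le (fun n => Im (u n)) b); [|exact Hex]. intros n.
  eapply Rle_trans; [apply Cmod_Im | apply Hb]. }
apply is_series_Cmod. intros eps He.
assert (He2 : 0 < eps / 2) by lra.
destruct (proj1 (filterlim_locally _ _) HR (mkposreal _ He2)) as [N1 H1].
destruct (proj1 (filterlim_locally _ _) HI (mkposreal _ He2)) as [N2 H2].
exists (max N1 N2). intros n Hn.
specialize (H1 n ltac:(lia)). specialize (H2 n ltac:(lia)).
eapply Rle_lt_trans; [apply Cmod_le_Re_Im|].
change (Rabs (sum_n (fun k => Re (u k)) n - Re (CSeries u)) < eps / 2) in H1.
change (Rabs (sum_n (fun k => Im (u k)) n - Im (CSeries u)) < eps / 2) in H2.
rewrite <- sum_n_Re in H1. rewrite <- sum_n_Im in H2.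
replace (Re (sum_n u n - CSeries u)) with (Re (sum_n u n) - Re (CSeries u)) by reflexivity.
replace (Im (sum_n u n - CSeries u)) with (Im (sum_n u n) - Im (CSeries u)) by reflexivity.
lra.
Qed.

Lemma is_series_Cminus (u v : nat -> C) (l m : C) :
  is_series u l -> is_series v m ->
  is_series (fun n => (u n - v n)%C) (l - m)%C.
Proof. intros. now apply (is_series_minus u v). Qed.

Lemma is_series_Cmult (c : C) (u : nat -> C) (l : C) :
  is_series u l -> is_series (fun n => (c * u n)%C) (c * l)%C.
Proof. intros. now apply (is_series_scal c u). Qed.

Lemma sum_n_Rmult_l (c : R) (u : nat -> R) (N : nat) :
  sum_n (fun n => c * u n) N = c * sum_n u N.
Proof. exact (sum_n_mult_l (K := R_Ring) c u N). Qed.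

Lemma sum_n_geom_le (q : R) (N : nat) : 0 <= q < 1 ->
  sum_n (fun n => q ^ n) N <= / (1 - q).
Proof.
intros Hq.
assert (E : sum_n (fun n => q ^ n) N * (1 - q) = 1 - q ^ S N).
{ induction N as [|N IH]; [rewrite sum_O; simpl; ring|].
  rewrite sum_Sn. unfold plus; simpl. simpl in IH. lra. }
apply Rmult_le_reg_r with (1 - q); [lra|]. rewrite E, Rinv_l by lra.
pose proof (pow_le q (S N) (proj1 Hq)). lra.
Qed.


(** * Finite sums *)

Lemma Csum_S (u : nat -> C) (N : nat) :
  (sum_n_m u 1 (S N) : C) = (sum_n_m u 1 N + u (S N))%C.
Proof. exact (sum_n_Sm u 1 N ltac:(lia)). Qed.

Lemma Csum_0 (u : nat -> C) : (sum_n_m u 1 0 : C) = RtoC 0.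
Proof. exact (sum_n_m_zero u 1 0 ltac:(lia)). Qed.

Lemma Csum_ext (u v : nat -> C) (N : nat) :
  (forall n, (1 <= n <= N)%nat -> u n = v n) -> (sum_n_m u 1 N : C) = sum_n_m v 1 N.
Proof. exact (sum_n_m_ext_loc u v 1 N). Qed.

Lemma Csum_plus (u v : nat -> C) (N : nat) :
  (sum_n_m (fun n => u n + v n)%C 1 N : C) = (sum_n_m u 1 N + sum_n_m v 1 N)%C.
Proof. exact (sum_n_m_plus u v 1 N). Qed.

Lemma Csum_mult_l (c : C) (u : nat -> C) (N : nat) :
  (sum_n_m (fun n => c * u n)%C 1 N : C) = (c * sum_n_m u 1 N)%C.
Proof. exact (sum_n_m_mult_l (K := C_Ring) c u 1 N). Qed.

Lemma Csum_minus (u v : nat -> C) (n m : nat) :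
  (sum_n_m (fun k => u k - v k)%C n m : C) = (sum_n_m u n m - sum_n_m v n m)%C.
Proof.
assert (E : forall x y z : C, (x + y)%C = z -> x = (z - y)%C) by (intros x y z <-; ring).
apply E. transitivity (sum_n_m (fun k => (u k - v k) + v k)%C n m : C).
- symmetry. exact (sum_n_m_plus (fun k => u k - v k)%C v n m).
- apply sum_n_m_ext. intros k. change (@eq C (u k - v k + v k)%C (u k)). ring.
Qed.

Lemma Rsum_S (u : nat -> R) (N : nat) :
  (sum_n_m u 1 (S N) : R) = sum_n_m u 1 N + u (S N).
Proof. exact (sum_n_Sm u 1 N ltac:(lia)). Qed.

Lemma Rsum_0 (u : nat -> R) : (sum_n_m u 1 0 : R) = 0.
Proof. exact (sum_n_m_zero u 1 0 ltac:(lia)). Qed.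

Lemma Rsum_plus (u v : nat -> R) (n m : nat) :
  (sum_n_m (fun n => u n + v n) n m : R) = sum_n_m u n m + sum_n_m v n m.
Proof. exact (sum_n_m_plus u v n m). Qed.

Lemma Rsum_mult_l (c : R) (u : nat -> R) (n m : nat) :
  (sum_n_m (fun n => c * u n) n m : R) = c * sum_n_m u n m.
Proof. exact (sum_n_m_mult_l (K := R_Ring) c u n m). Qed.

Lemma Rsum_le_loc (u v : nat -> R) (n m : nat) :
  (forall k, (n <= k <= m)%nat -> u k <= v k) -> sum_n_m u n m <= sum_n_m v n m.
Proof.
intros H.
(* [sum_n_m_le] compares all terms, so those out of range are set to 0 *)
set (cut := fun (w : nat -> R) k =>
  if andb (Nat.leb n k) (Nat.leb k m) then w k else 0).
assert (E : forall w : nat -> R, (sum_n_m w n m : R) = sum_n_m (cut w) n m).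
{ intros w. apply sum_n_m_ext_loc. intros k Hk. unfold cut.
  now rewrite (proj2 (Nat.leb_le n k)), (proj2 (Nat.leb_le k m)) by lia. }
rewrite (E u), (E v). apply sum_n_m_le. intros k. unfold cut.
destruct (Nat.leb_spec n k), (Nat.leb_spec k m); simpl; try lra. now apply H.
Qed.

Lemma Rsum_nonneg (u : nat -> R) (n m : nat) :
  (forall k, (n <= k <= m)%nat -> 0 <= u k) -> 0 <= sum_n_m u n m.
Proof.
intros H. rewrite <- (Rmult_0_r (INR (S m - n))), <- (sum_n_m_const n m 0).
now apply Rsum_le_loc.
Qed.

Lemma Rsum_ge_term (u : nat -> R) (n m i : nat) :
  (forall k, (n <= k <= m)%nat -> 0 <= u k) -> (n <= i <= m)%nat ->
  u i <= sum_n_m u n m.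
Proof.
intros H Hi.
rewrite <- (sum_n_n u i) at 1.
destruct (Nat.eq_dec i m) as [->|Him].
- destruct (Nat.eq_dec n m) as [->|Hnm]; [lra|].
  destruct m as [|m]; [lia|]. rewrite (sum_n_Sm u n m) by lia.
  rewrite sum_n_n. change plus with Rplus.
  pose proof (Rsum_nonneg u n m ltac:(intros; apply H; lia)). lra.
- rewrite (sum_n_m_Chasles u n i m) by lia. change plus with Rplus.
  pose proof (Rsum_nonneg u (S i) m ltac:(intros; apply H; lia)) as H1.
  destruct (Nat.eq_dec n i) as [->|Hni]; [lra|].
  destruct i as [|i]; [lia|]. rewrite (sum_n_Sm u n i) by lia.
  rewrite sum_n_n. change plus with Rplus.
  pose proof (Rsum_nonneg u n i ltac:(intros; apply H; lia)). lra.
Qed.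

Lemma Rsum_ge_two_terms (u : nat -> R) (m i : nat) :
  (forall k, (1 <= k <= m)%nat -> 0 <= u k) -> (1 < i <= m)%nat ->
  u 1%nat + u i <= sum_n_m u 1 m.
Proof.
intros H Hi. rewrite (sum_Sn_m u 1 m) by lia. change plus with Rplus.
apply Rplus_le_compat_l, Rsum_ge_term; [intros; apply H; lia | lia].
Qed.

Lemma Csum_Cmod_le (u : nat -> C) (b : nat -> R) (n m : nat) :
  (forall k, (n <= k <= m)%nat -> Cmod (u k) <= b k) ->
  Cmod (sum_n_m u n m) <= sum_n_m b n m.
Proof.
intros H. eapply Rle_trans; [|apply Rsum_le_loc, H].
exact (norm_sum_n_m (V := C_NormedModule) u n m).
Qed.

Lemma Re_RtoC_mult (x : R) (z : C) : Re (RtoC x * z) = x * Re z.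
Proof. unfold Re; simpl; ring. Qed.

(** * Perturbations of real-linear isomorphisms of the plane *)

(** The contraction principle, with the limit of the Picard iterates obtained as
    the sum of their increments, a series dominated by a geometric one. *)
Lemma fixed_point_closed_disk (T : C -> C) (r q : R) :
  0 <= r -> 0 <= q < 1 ->
  (forall z, Cmod z <= r -> Cmod (T z) <= r) ->
  (forall z w, Cmod z <= r -> Cmod w <= r ->
     Cmod (T z - T w) <= q * Cmod (z - w)) ->
  exists z, Cmod z <= r /\ T z = z.
Proof.
intros Hr Hq Hmap Hlip.
set (x := fun n => Nat.iter n T (RtoC 0)).
assert (Hx : forall n, Cmod (x n) <= r).
{ induction n as [|n IH]; [unfold x; simpl; rewrite Cmod_0; lra | now apply Hmap]. }
set (d := Cmod (x 1%nat - x 0%nat)).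
assert (Hd : forall n, Cmod (x (S n) - x n) <= d * q ^ n).
{ induction n as [|n IH]; [unfold d; simpl; lra|].
  change (Cmod (T (x (S n)) - T (x n)) <= d * q ^ S n).
  eapply Rle_trans; [apply Hlip; apply Hx|]. simpl.
  replace (d * (q * q ^ n)) with (q * (d * q ^ n)) by ring.
  apply Rmult_le_compat_l; [lra | exact IH]. }
assert (Hs : is_series (fun n => x (S n) - x n)%C (CSeries (fun n => x (S n) - x n)%C)).
{ apply CSeries_correct with (fun n => d * q ^ n) (d * / (1 - q)); [exact Hd|].
  intros N. rewrite sum_n_Rmult_l.
  apply Rmult_le_compat_l; [apply Cmod_ge_0 | now apply sum_n_geom_le]. }
set (l := CSeries (fun n => x (S n) - x n)%C) in Hs.
assert (E : forall n, sum_n (fun n => x (S n) - x n)%C n = x (S n)).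
{ induction n as [|n IH]; [rewrite sum_O; unfold x; simpl; ring|].
  rewrite sum_Sn, IH.
  change (x (S n) + (x (S (S n)) - x (S n)) = x (S (S n)))%C. ring. }
assert (Hl : forall eps, 0 < eps ->
  exists N, forall n, (N <= n)%nat -> Cmod (x (S n) - l) < eps).
{ intros eps He. destruct (proj1 (is_series_Cmod _ _) Hs eps He) as [N HN].
  exists N. intros n Hn. rewrite <- E. now apply HN. }
assert (Hlr : Cmod l <= r).
{ apply le_epsilon. intros eps He. destruct (Hl eps He) as [N HN].
  specialize (HN N (le_n _)). rewrite Cmod_minus_sym in HN.
  pose proof (Cmod_triangle_rev l (x (S N))). specialize (Hx (S N)). lra. }
exists l. split; [exact Hlr|].
apply Cminus_eq_0. apply le_epsilon. intros eps He.
destruct (Hl (eps / 2) ltac:(lra)) as [N HN].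
pose proof (HN N (le_n _)) as H1. pose proof (HN (S N) ltac:(lia)) as H2.
pose proof (Hlip l (x (S N)) Hlr (Hx _)) as H3.
rewrite (Cmod_minus_sym l) in H3.
change (T (x (S N))) with (x (S (S N))) in H3.
replace (T l - l)%C with ((T l - x (S (S N))) + (x (S (S N)) - l))%C by ring.
eapply Rle_trans; [apply Cmod_triangle|].
assert (q * Cmod (x (S N) - l) <= 1 * Cmod (x (S N) - l))
  by (apply Rmult_le_compat_r; [apply Cmod_ge_0 | lra]).
lra.
Qed.

Lemma open_Cmod (V : C -> Prop) :
  open V <-> forall z, V z -> exists d, 0 < d /\ forall w, Cmod (w - z) < d -> V w.
Proof.
split.
- intros H z Hz. destruct (H z Hz) as [eps He].
  exists eps. split; [apply cond_pos|]. intros w Hw. apply He.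
  now apply C_NormedModule_mixin_compat1.
- intros H z Hz. destruct (H z Hz) as [d [Hd Hw]].
  assert (Hs : 0 < sqrt 2) by (apply sqrt_lt_R0; lra).
  assert (He : 0 < d / sqrt 2) by (apply Rdiv_lt_0_compat; lra).
  exists (mkposreal _ He). intros w Hb. apply Hw.
  apply C_NormedModule_mixin_compat2 in Hb. simpl in Hb.
  replace (sqrt 2 * (d / sqrt 2)) with d in Hb by (field; lra). exact Hb.
Qed.

Lemma segment_Cmod (z w : C) (r t : R) :
  Cmod z < r -> Cmod w < r -> 0 <= t <= 1 ->
  Cmod (RtoC (1 - t) * z + RtoC t * w) < r.
Proof.
intros Hz Hw Ht. eapply Rle_lt_trans; [apply Cmod_triangle|].
rewrite !Cmod_mult, !Cmod_R, !Rabs_pos_eq by lra.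
destruct (Req_dec t 0) as [->|Ht0]; [lra|]. nra.
Qed.

(** If V and W separated the image, the curve traced by G along a segment would
    start in V and end in W; at the supremum of the parameters with value in V
    it could lie in neither open set. *)
Lemma connected_image_disk (rho : R) (G : C -> C) :
  (forall w, disk rho w -> forall eps, 0 < eps ->
     exists d, 0 < d /\
       forall w', disk rho w' -> Cmod (w' - w) < d -> Cmod (G w' - G w) < eps) ->
  connected_set (fun z => exists w, disk rho w /\ G w = z).
Proof.
intros HG V W HV HW Hcov [z1 [[w1 [Hw1 E1]] Hz1]] [z2 [[w2 [Hw2 E2]] Hz2]].
pose proof (proj1 (open_Cmod V) HV) as HV'. pose proof (proj1 (open_Cmod W) HW) as HW'.
destruct (classic (exists z, (exists w, disk rho w /\ G w = z) /\ V z /\ W z))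
  as [Hyes|Hno]; [exact Hyes|exfalso].
set (c := fun t : R => (RtoC (1 - t) * w1 + RtoC t * w2)%C).
assert (Hc : forall t, 0 <= t <= 1 -> disk rho (c t)).
{ intros t Ht. now apply segment_Cmod. }
assert (Hcc : forall t eps, 0 <= t <= 1 -> 0 < eps -> exists d, 0 < d /\
  forall s, 0 <= s <= 1 -> Rabs (s - t) < d -> Cmod (G (c s) - G (c t)) < eps).
{ intros t eps Ht He. destruct (HG (c t) (Hc t Ht) eps He) as [d [Hd Hd']].
  set (L := Cmod (w2 - w1) + 1).
  assert (HL : 0 < L) by (unfold L; pose proof (Cmod_ge_0 (w2 - w1)); lra).
  exists (d / L). split; [now apply Rdiv_lt_0_compat|].
  intros s Hs Hst. apply Hd'; [now apply Hc|].
  replace (c s - c t)%C with (RtoC (s - t) * (w2 - w1))%C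
    by (unfold c; rewrite !RtoC_minus; ring).
  rewrite Cmod_mult, Cmod_R.
  apply Rle_lt_trans with (Rabs (s - t) * L).
  - apply Rmult_le_compat_l; [apply Rabs_pos | unfold L; lra].
  - apply Rmult_lt_reg_r with (/ L); [now apply Rinv_0_lt_compat|].
    rewrite Rmult_assoc, Rinv_r by lra. rewrite Rmult_1_r. exact Hst. }
set (A := fun t => 0 <= t <= 1 /\ V (G (c t))).
assert (Hc0 : c 0 = w1) by (unfold c; rewrite Rminus_0_r; ring).
assert (Hc1 : c 1 = w2)
  by (unfold c; replace (1 - 1) with 0 by ring; ring).
destruct (completeness A) as [s [Hub Hlub]].
{ exists 1. intros t [Ht _]. lra. }
{ exists 0. split; [lra|]. rewrite Hc0, E1. exact Hz1. }
assert (Hs : 0 <= s <= 1).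
{ split.
  - apply Hub. split; [lra|]. rewrite Hc0, E1. exact Hz1.
  - apply Hlub. intros t [Ht _]. lra. }
destruct (Hcov (G (c s))) as [Hv|Hw]; [exists (c s); split; [now apply Hc|easy]| |].
- (* past the supremum the curve would still be in [V] *)
  destruct (HV' _ Hv) as [e [He Hball]].
  destruct (Hcc s e Hs He) as [d [Hd Hd']].
  destruct (Req_dec s 1) as [->|Hs1].
  + apply Hno. exists (G (c 1)). split; [exists (c 1); split; [apply Hc; lra|easy]|].
    split; [exact Hv|]. rewrite Hc1, E2. exact Hz2.
  + set (t := Rmin 1 (s + d / 2)).
    assert (Ht : s < t <= 1 /\ t < s + d).
    { unfold t, Rmin. destruct (Rle_dec 1 (s + d / 2)); lra. }
    assert (HA : A t).
    { split; [lra|]. apply Hball. apply Hd'; [lra|].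
      rewrite Rabs_pos_eq; lra. }
    specialize (Hub t HA). lra.
- (* just before the supremum the curve is already in [W] *)
  destruct (HW' _ Hw) as [e [He Hball]].
  destruct (Hcc s e Hs He) as [d [Hd Hd']].
  assert (Hub' : is_upper_bound A (s - d)).
  { intros t Ht. destruct (Rle_dec t (s - d)) as [|Hn]; [easy|exfalso].
    pose proof (Hub t Ht) as Hts. destruct Ht as [Ht Hvt].
    apply Hno. exists (G (c t)).
    split; [exists (c t); split; [now apply Hc|easy]|]. split; [exact Hvt|].
    apply Hball. apply Hd'; [lra|]. rewrite Rabs_left1; lra. }
  specialize (Hlub _ Hub'). lra.
Qed.

(** The inverse is explicit, with determinant |al|^2 - |be|^2. *)
Lemma real_linear_surj (al be w : C) : Cmod al <> Cmod be ->
  exists z, (al * z + be * Cconj z)%C = w.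
Proof.
intros Hne.
assert (Hd : Cmod al ^ 2 - Cmod be ^ 2 <> 0).
{ intros H. apply Hne. pose proof (Cmod_ge_0 al). pose proof (Cmod_ge_0 be). nra. }
set (d := Cmod al ^ 2 - Cmod be ^ 2) in Hd.
assert (Ed : RtoC d = (al * Cconj al - be * Cconj be)%C).
{ unfold d. rewrite RtoC_minus. now rewrite !Cmod2_conj. }
assert (Hd' : RtoC d <> 0%C) by (intros H; apply Hd; now apply RtoC_inj).
exists ((Cconj al * w - be * Cconj w) * RtoC (/ d))%C.
rewrite Cmult_conj, Cminus_conj, !Cmult_conj, !Cconj_conj.
replace (Cconj (RtoC (/ d))) with (RtoC (/ d))
  by (apply injective_projections; simpl; ring).
replace (al * ((Cconj al * w - be * Cconj w) * RtoC (/ d)) +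
  be * ((al * Cconj w - Cconj be * w) * RtoC (/ d)))%C
  with ((al * Cconj al - be * Cconj be) * w * RtoC (/ d))%C by ring.
rewrite <- Ed, RtoC_inv by exact Hd. field. exact Hd'.
Qed.

Lemma real_linear_lower (al be z : C) :
  Rabs (Cmod al - Cmod be) * Cmod z <= Cmod (al * z + be * Cconj z).
Proof.
replace (Rabs (Cmod al - Cmod be) * Cmod z)
  with (Rabs (Cmod (al * z) - Cmod (- (be * Cconj z)))).
2:{ rewrite Cmod_opp, !Cmod_mult, Cmod_conj.
    rewrite <- (Rabs_pos_eq (Cmod z)) at 3 by apply Cmod_ge_0.
    rewrite <- Rabs_mult. f_equal. ring. }
replace (al * z + be * Cconj z)%C with (al * z - - (be * Cconj z))%C by ring.
apply Rabs_le. split.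
- pose proof (Cmod_triangle_rev (- (be * Cconj z)) (al * z)) as H.
  rewrite Cmod_minus_sym in H. lra.
- apply Cmod_triangle_rev.
Qed.

(** A map P whose Lipschitz constant is smaller than the lower dilatation of the
    linear part cannot destroy its expansion.  The contraction factor may tend
    to 1 as r tends to R, so the constant is only uniform on smaller disks. *)
Lemma perturbation_expanding (T P : C -> C) (al be : C) (lam R : R) :
  lam = Rabs (Cmod al - Cmod be) -> 0 < lam ->
  (forall z, disk R z -> T z = (al * z + be * Cconj z + P z)%C) ->
  (forall r, 0 <= r < R -> exists q, 0 <= q < 1 /\
     forall z w, Cmod z <= r -> Cmod w <= r ->
       Cmod (P z - P w) <= lam * q * Cmod (z - w)) ->
  (forall r, 0 <= r < R -> exists c, 0 < c /\
     forall z w, Cmod z <= r -> Cmod w <= r ->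
       c * Cmod (z - w) <= Cmod (T z - T w)).
Proof.
intros El Hl HT HP r Hr. destruct (HP r Hr) as [q [Hq Hlip]].
exists (lam * (1 - q)). split; [apply Rmult_lt_0_compat; lra|].
intros z w Hz Hw. rewrite !HT by (unfold disk; lra).
specialize (Hlip z w Hz Hw).
pose proof (real_linear_lower al be (z - w)) as H. rewrite <- El in H.
replace (al * z + be * Cconj z + P z - (al * w + be * Cconj w + P w))%C
  with ((al * (z - w) + be * Cconj (z - w)) - (P w - P z))%C
  by (rewrite Cminus_conj; ring).
pose proof (Cmod_triangle_rev (al * (z - w) + be * Cconj (z - w)) (P w - P z)).
rewrite (Cmod_minus_sym (P w)) in H0. lra.
Qed.

(** Injectivity comes from the expansion, surjectivity from the contraction
    z |-> Lambda^{-1} (w - P z), which maps the closed disk of radius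
    r = |w| / (lam (1 - s)) into itself.  The solution depends on w in a locally
    Lipschitz way, which makes the set of solutions a domain. *)
Lemma perturbation_contains_disk (T P : C -> C) (al be : C) (lam R s rho : R) :
  lam = Rabs (Cmod al - Cmod be) -> 0 < lam -> 0 < R ->
  (forall z, disk R z -> T z = (al * z + be * Cconj z + P z)%C) ->
  (forall r, 0 <= r < R -> exists q, 0 <= q < 1 /\
     forall z w, Cmod z <= r -> Cmod w <= r ->
       Cmod (P z - P w) <= lam * q * Cmod (z - w)) ->
  0 <= s < 1 ->
  (forall z, disk R z -> Cmod (P z) <= lam * s * Cmod z) ->
  0 < rho <= lam * R * (1 - s) ->
  univalent_on (disk R) T /\ contains_univalent_disk T R rho.
Proof.
intros El Hl HR HT HP Hs HPs Hrho.
pose proof (perturbation_expanding T P al be lam R El Hl HT HP) as Hexp.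
assert (Huniv : univalent_on (disk R) T).
{ intros z w Hz Hw E. unfold disk in *.
  destruct (Hexp (Rmax (Cmod z) (Cmod w))) as [c [Hc Hc']].
  { split; [eapply Rle_trans; [apply (Cmod_ge_0 z) | apply Rmax_l]|].
    now apply Rmax_lub_lt. }
  specialize (Hc' z w (Rmax_l _ _) (Rmax_r _ _)).
  replace (T z - T w)%C with (RtoC 0) in Hc' by (rewrite E; ring).
  rewrite Cmod_0 in Hc'. apply Cminus_eq_0. nra. }
split; [exact Huniv|].
set (k := lam * (1 - s)).
assert (Hk : 0 < k) by (apply Rmult_lt_0_compat; lra).
assert (Hsurj : forall r w, 0 <= r < R -> Cmod w <= k * r ->
  exists z, Cmod z <= r /\ T z = w).
{ intros r w Hr Hw. destruct (HP r Hr) as [q [Hq Hlip]].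
  assert (Hne : Cmod al <> Cmod be).
  { intros E. rewrite E in El. replace (Cmod be - Cmod be) with 0 in El by ring.
    rewrite Rabs_R0 in El. lra. }
  set (inv := fun v => proj1_sig
     (constructive_indefinite_description _ (real_linear_surj al be v Hne))).
  assert (Hinv : forall v, (al * inv v + be * Cconj (inv v))%C = v).
  { intros v. unfold inv. now destruct (constructive_indefinite_description _ _). }
  assert (Hlow : forall v, lam * Cmod (inv v) <= Cmod v).
  { intros v. rewrite <- (Hinv v) at 2. rewrite El. apply real_linear_lower. }
  destruct (fixed_point_closed_disk (fun z => inv (w - P z)%C) r q) as [z [Hz E]];
    [lra|exact Hq| | |].
  - intros z Hz. apply Rmult_le_reg_l with lam; [exact Hl|].
    eapply Rle_trans; [apply Hlow|].
    eapply Rle_trans; [apply Cmod_triangle_minus|].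
    specialize (HPs z ltac:(unfold disk; lra)).
    assert (lam * s * Cmod z <= lam * s * r).
    { apply Rmult_le_compat_l; [apply Rmult_le_pos; lra | exact Hz]. }
    unfold k in Hw. nra.
  - intros z z' Hz Hz'. apply Rmult_le_reg_l with lam; [exact Hl|].
    assert (Ed : forall v v', (al * (inv v - inv v') + be * Cconj (inv v - inv v'))%C = (v - v')%C).
    { intros v v'. rewrite <- (Hinv v) at 3. rewrite <- (Hinv v') at 3.
      rewrite Cminus_conj. ring. }
    pose proof (real_linear_lower al be (inv (w - P z) - inv (w - P z'))%C) as H.
    rewrite Ed, <- El in H.
    replace (w - P z - (w - P z'))%C with (P z' - P z)%C in H by ring.
    rewrite (Cmod_minus_sym (P z')) in H.
    specialize (Hlip z z' Hz Hz'). lra.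
  - exists z. split; [exact Hz|].
    pose proof (Hinv (w - P z)%C) as H. simpl in E. rewrite E in H.
    rewrite HT by (unfold disk; lra). rewrite H. ring. }
assert (HG : forall w, disk rho w ->
  exists z, Cmod z <= Cmod w / k /\ T z = w).
{ intros w Hw. unfold disk in Hw. apply Hsurj.
  - split; [apply Rdiv_le_0_compat; [apply Cmod_ge_0 | exact Hk]|].
    apply Rmult_lt_reg_r with k; [exact Hk|].
    unfold Rdiv. rewrite Rmult_assoc, Rinv_l by lra. unfold k in *. lra.
  - right. field. lra. }
set (G := fun w => epsilon (inhabits (RtoC 0))
  (fun z => Cmod z <= Cmod w / k /\ T z = w)).
assert (HG' : forall w, disk rho w -> Cmod (G w) <= Cmod w / k /\ T (G w) = w).
{ intros w Hw. exact (epsilon_spec (inhabits (RtoC 0)) _ (HG w Hw)). }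
assert (Hsmall : forall m, m < rho -> m / k < R).
{ intros m Hm. apply Rmult_lt_reg_r with k; [exact Hk|].
  unfold Rdiv. rewrite Rmult_assoc, Rinv_l by lra. unfold k in *. lra. }
assert (Hdiv : forall m m', m <= m' -> m / k <= m' / k).
{ intros m m' Hm. apply Rmult_le_compat_r; [|exact Hm].
  left. now apply Rinv_0_lt_compat. }
assert (HGR : forall w, disk rho w -> disk R (G w)).
{ intros w Hw. eapply Rle_lt_trans; [apply HG', Hw | now apply Hsmall]. }
exists (fun z => exists w, disk rho w /\ G w = z).
split; [split; [|split]|split; [|split]].
- apply open_Cmod. intros z [w [Hw Ez]].
  assert (Hz : disk R z) by (rewrite <- Ez; now apply HGR).
  assert (HTz : T z = w) by (rewrite <- Ez; now apply HG').
  unfold disk in Hz, Hw.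
  destruct (HP ((Cmod z + R) / 2)) as [q [Hq Hlip]].
  { pose proof (Cmod_ge_0 z). lra. }
  set (L := Cmod al + Cmod be + lam * q + 1).
  assert (HL : 0 < L).
  { unfold L. pose proof (Cmod_ge_0 al). pose proof (Cmod_ge_0 be).
    assert (0 <= lam * q) by (apply Rmult_le_pos; lra). lra. }
  exists (Rmin ((R - Cmod z) / 2) ((rho - Cmod w) / L)).
  split; [apply Rmin_pos; [lra | apply Rdiv_lt_0_compat; lra]|].
  intros z' Hz'.
  pose proof (Rlt_le_trans _ _ _ Hz' (Rmin_l _ _)) as H1.
  pose proof (Rlt_le_trans _ _ _ Hz' (Rmin_r _ _)) as H2.
  pose proof (Cmod_triangle_rev z' z) as H3.
  assert (Hz'R : disk R z') by (unfold disk; lra).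
  assert (HTz' : disk rho (T z')).
  { pose proof (Cmod_triangle_rev (T z') (T z)) as H4. rewrite HTz in H4 at 1.
    assert (H5 : Cmod (T z' - T z) <= L * Cmod (z' - z)).
    { rewrite !HT by easy.
      replace (al * z' + be * Cconj z' + P z' - (al * z + be * Cconj z + P z))%C
        with (al * (z' - z) + be * Cconj (z' - z) + (P z' - P z))%C
        by (rewrite Cminus_conj; ring).
      eapply Rle_trans; [apply Cmod_triangle|].
      eapply Rle_trans; [apply Rplus_le_compat_r, Cmod_triangle|].
      rewrite !Cmod_mult, Cmod_conj.
      specialize (Hlip z' z ltac:(lra) ltac:(lra)).
      pose proof (Cmod_ge_0 (z' - z)). unfold L. lra. }
    assert (H6 : Cmod (z' - z) * L < rho - Cmod w).
    { apply Rmult_lt_reg_r with (/ L); [now apply Rinv_0_lt_compat|].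
      rewrite Rmult_assoc, Rinv_r, Rmult_1_r by lra. exact H2. }
    unfold disk. lra. }
  exists (T z'). split; [exact HTz'|].
  apply Huniv; [now apply HGR | exact Hz'R | now apply HG'].
- apply connected_image_disk. intros w Hw eps He. unfold disk in Hw.
  set (m := (Cmod w + rho) / 2).
  destruct (Hexp (m / k)) as [c [Hc Hc']].
  { split; [|apply Hsmall; unfold m; lra].
    apply Rdiv_le_0_compat; [|exact Hk]. unfold m. pose proof (Cmod_ge_0 w). lra. }
  exists (Rmin ((rho - Cmod w) / 2) (c * eps)).
  split; [apply Rmin_pos; [lra | now apply Rmult_lt_0_compat]|].
  intros w' Hw' Hd.
  pose proof (Rlt_le_trans _ _ _ Hd (Rmin_l _ _)) as H1.
  pose proof (Rlt_le_trans _ _ _ Hd (Rmin_r _ _)) as H2.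
  pose proof (Cmod_triangle_rev w' w) as H3.
  destruct (HG' w Hw) as [H4 H5]. destruct (HG' w' Hw') as [H6 H7].
  assert (H8 : c * Cmod (G w' - G w) <= Cmod (w' - w)).
  { rewrite <- H5 at 2. rewrite <- H7 at 2. apply Hc'.
    - eapply Rle_trans; [exact H6|]. apply Hdiv. unfold m. lra.
    - eapply Rle_trans; [exact H4|]. apply Hdiv. unfold m. lra. }
  apply Rmult_lt_reg_l with c; lra.
- exists (G 0%C). exists 0%C. split; [|easy]. unfold disk. rewrite Cmod_0. lra.
- intros z [w [Hw <-]]. now apply HGR.
- intros z z' [w [Hw Ez]] [w' [Hw' Ez']] E. subst z z'.
  apply Huniv; [now apply HGR | now apply HGR | exact E].
- intros w. split.
  + intros Hw. exists (G w). split; [now exists w | now apply HG'].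
  + intros [z [[w' [Hw' <-]] E]]. rewrite (proj2 (HG' w' Hw')) in E.
    now subst w'.
Qed.

(** * Wirtinger derivatives *)

(** Real differentiability, with differential p dz + q d(conj z); the case q = 0
    is complex differentiability. *)
Definition wirtinger (F : C -> C) (z p q : C) : Prop :=
  forall eps, 0 < eps -> exists d, 0 < d /\ forall w, Cmod w < d ->
    Cmod (F (z + w)%C - F z - (p * w + q * Cconj w)) <= eps * Cmod w.

Lemma is_derive_of_remainder (f : R -> R) (x l : R) :
  (forall eps, 0 < eps -> exists d, 0 < d /\ forall h, Rabs h < d ->
     Rabs (f (x + h) - f x - l * h) <= eps * Rabs h) ->
  Derive f x = l.
Proof.
intros H. apply is_derive_unique, is_derive_Reals.
intros eps He. destruct (H (eps / 2) ltac:(lra)) as [d [Hd Hd']].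
exists (mkposreal d Hd). simpl. intros h Hh Hhd.
specialize (Hd' h Hhd).
replace ((f (x + h) - f x) / h - l) with ((f (x + h) - f x - l * h) / h)
  by (field; exact Hh).
unfold Rdiv. rewrite Rabs_mult, Rabs_inv.
assert (0 < Rabs h) by now apply Rabs_pos_lt.
apply Rle_lt_trans with (eps / 2 * Rabs h * / Rabs h).
- apply Rmult_le_compat_r; [left; now apply Rinv_0_lt_compat | exact Hd'].
- rewrite Rmult_assoc, Rinv_r by lra. lra.
Qed.

Lemma wirtinger_d (F : C -> C) (z p q : C) :
  wirtinger F z p q -> d_z F z = p /\ d_zbar F z = q.
Proof.
intros H.
assert (Hx : partial_x F z = (p + q)%C).
{ apply injective_projections; simpl; apply is_derive_of_remainder;
    intros eps He; destruct (H eps He) as [d [Hd Hd']]; exists d;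
    (split; [exact Hd|]); intros h Hh;
    specialize (Hd' (RtoC h)); rewrite Cmod_R in Hd'; specialize (Hd' Hh);
    (eapply Rle_trans; [|exact Hd']);
    replace (z + RtoC h)%C with (Re z + h, Im z)
      by (apply injective_projections; simpl; unfold Re, Im; ring);
    [eapply Rle_trans; [|apply re_le_Cmod] | eapply Rle_trans; [|apply Cmod_Im]];
    right; f_equal; replace (Re z, Im z) with z by apply surjective_pairing;
    unfold Re, Im; simpl; ring. }
assert (Hy : partial_y F z = (Ci * (p - q))%C).
{ apply injective_projections; simpl; apply is_derive_of_remainder;
    intros eps He; destruct (H eps He) as [d [Hd Hd']]; exists d;
    (split; [exact Hd|]); intros h Hh;
    specialize (Hd' (Ci * RtoC h)%C);
    rewrite Cmod_mult, Cmod_Ci, Cmod_R, Rmult_1_l in Hd'; specialize (Hd' Hh);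
    (eapply Rle_trans; [|exact Hd']);
    replace (z + Ci * RtoC h)%C with (Re z, Im z + h)
      by (apply injective_projections; simpl; unfold Re, Im; ring);
    [eapply Rle_trans; [|apply re_le_Cmod] | eapply Rle_trans; [|apply Cmod_Im]];
    right; f_equal; replace (Re z, Im z) with z by apply surjective_pairing;
    unfold Re, Im; simpl; ring. }
assert (HC : forall u : C, (u / 2)%C = (RtoC (/ 2) * u)%C).
{ intros u. unfold Cdiv. rewrite <- RtoC_inv by lra. ring. }
unfold d_z, d_zbar. rewrite Hx, Hy, !HC.
split; apply injective_projections; simpl; field.
Qed.

Lemma wirtinger_eq (F : C -> C) (z p q p' q' : C) :
  wirtinger F z p q -> p = p' -> q = q' -> wirtinger F z p' q'.
Proof. now intros H <- <-. Qed.

Lemma wirtinger_ext_disk (F G : C -> C) (r : R) (z p q : C) :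
  disk r z -> (forall w, disk r w -> F w = G w) ->
  wirtinger F z p q -> wirtinger G z p q.
Proof.
unfold disk. intros Hz E H eps He. destruct (H eps He) as [d [Hd Hd']].
exists (Rmin d (r - Cmod z)). split; [apply Rmin_pos; lra|].
intros w Hw.
pose proof (Rlt_le_trans _ _ _ Hw (Rmin_l _ _)).
pose proof (Rlt_le_trans _ _ _ Hw (Rmin_r _ _)).
pose proof (Cmod_triangle z w).
rewrite <- !E by lra. now apply Hd'.
Qed.

Lemma wirtinger_const (c z : C) : wirtinger (fun _ => c) z 0 0.
Proof.
intros eps He. exists 1. split; [lra|]. intros w _.
replace (c - c - (0 * w + 0 * Cconj w))%C with (RtoC 0) by ring.
rewrite Cmod_0. apply Rmult_le_pos; [lra | apply Cmod_ge_0].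
Qed.

Lemma wirtinger_id (z : C) : wirtinger (fun z => z) z (RtoC 1) (RtoC 0).
Proof.
intros eps He. exists 1. split; [lra|]. intros w _.
replace (z + w - z - (1 * w + 0 * Cconj w))%C with (RtoC 0) by ring.
rewrite Cmod_0. apply Rmult_le_pos; [lra | apply Cmod_ge_0].
Qed.

Lemma wirtinger_Cconj (F : C -> C) (z p q : C) :
  wirtinger F z p q -> wirtinger (fun z => Cconj (F z)) z (Cconj q) (Cconj p).
Proof.
intros H eps He. destruct (H eps He) as [d [Hd Hd']].
exists d. split; [exact Hd|]. intros w Hw. specialize (Hd' w Hw).
rewrite <- Cmod_conj, !Cminus_conj, Cplus_conj, !Cmult_conj, Cconj_conj in Hd'.
now rewrite (Cplus_comm (Cconj q * w)).
Qed.

Lemma wirtinger_plus (F G : C -> C) (z p q p' q' : C) :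
  wirtinger F z p q -> wirtinger G z p' q' ->
  wirtinger (fun z => F z + G z)%C z (p + p') (q + q').
Proof.
intros HF HG eps He.
destruct (HF (eps / 2) ltac:(lra)) as [d1 [Hd1 H1]].
destruct (HG (eps / 2) ltac:(lra)) as [d2 [Hd2 H2]].
exists (Rmin d1 d2). split; [now apply Rmin_pos|]. intros w Hw.
specialize (H1 w (Rlt_le_trans _ _ _ Hw (Rmin_l _ _))).
specialize (H2 w (Rlt_le_trans _ _ _ Hw (Rmin_r _ _))).
replace (F (z + w)%C + G (z + w)%C - (F z + G z) -
  ((p + p') * w + (q + q') * Cconj w))%C
  with ((F (z + w)%C - F z - (p * w + q * Cconj w)) +
        (G (z + w)%C - G z - (p' * w + q' * Cconj w)))%C by ring.
eapply Rle_trans; [apply Cmod_triangle|]. lra.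
Qed.

Lemma wirtinger_increment (F : C -> C) (z p q : C) :
  wirtinger F z p q -> exists L d, 0 < L /\ 0 < d /\ forall w, Cmod w < d ->
    Cmod (F (z + w)%C - F z) <= L * Cmod w.
Proof.
intros H. destruct (H 1 ltac:(lra)) as [d [Hd H']].
exists (Cmod p + Cmod q + 1), d.
pose proof (Cmod_ge_0 p). pose proof (Cmod_ge_0 q).
split; [lra|]. split; [exact Hd|]. intros w Hw. specialize (H' w Hw).
replace (F (z + w)%C - F z)%C with
  ((F (z + w)%C - F z - (p * w + q * Cconj w)) + (p * w + q * Cconj w))%C by ring.
eapply Rle_trans; [apply Cmod_triangle|].
pose proof (Cmod_triangle (p * w) (q * Cconj w)) as H2.
rewrite !Cmod_mult, Cmod_conj in H2. lra.
Qed.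

Lemma wirtinger_mult (F G : C -> C) (z p q p' q' : C) :
  wirtinger F z p q -> wirtinger G z p' q' ->
  wirtinger (fun z => F z * G z)%C z (p * G z + F z * p') (q * G z + F z * q').
Proof.
intros HF HG eps He.
destruct (wirtinger_increment _ _ _ _ HF) as (L1 & d1 & HL1 & Hd1 & H1).
destruct (wirtinger_increment _ _ _ _ HG) as (L2 & d2 & HL2 & Hd2 & H2).
pose proof (Cmod_ge_0 (F z)) as HF0. pose proof (Cmod_ge_0 (G z)) as HG0.
set (e1 := eps / 3 / (Cmod (G z) + 1)). set (e2 := eps / 3 / (Cmod (F z) + 1)).
assert (He1 : 0 < e1) by (unfold e1; apply Rdiv_lt_0_compat; lra).
assert (He2 : 0 < e2) by (unfold e2; apply Rdiv_lt_0_compat; lra).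
destruct (HF e1 He1) as [d3 [Hd3 H3]].
destruct (HG e2 He2) as [d4 [Hd4 H4]].
set (d5 := eps / 3 / (L1 * L2)).
assert (HL : 0 < L1 * L2) by now apply Rmult_lt_0_compat.
assert (Hd5 : 0 < d5) by (unfold d5; apply Rdiv_lt_0_compat; lra).
exists (Rmin (Rmin d1 d2) (Rmin (Rmin d3 d4) d5)).
split; [repeat apply Rmin_pos; easy|]. intros w Hw.
apply Rmin_Rgt_l in Hw. destruct Hw as [Hw1 Hw2].
apply Rmin_Rgt_l in Hw1. apply Rmin_Rgt_l in Hw2.
destruct Hw2 as [Hw2 Hw5]. apply Rmin_Rgt_l in Hw2.
specialize (H1 w (proj1 Hw1)). specialize (H2 w (proj2 Hw1)).
specialize (H3 w (proj1 Hw2)). specialize (H4 w (proj2 Hw2)).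
set (E1 := (F (z + w)%C - F z - (p * w + q * Cconj w))%C) in H3.
set (E2 := (G (z + w)%C - G z - (p' * w + q' * Cconj w))%C) in H4.
replace (F (z + w)%C * G (z + w)%C - F z * G z -
  ((p * G z + F z * p') * w + (q * G z + F z * q') * Cconj w))%C
  with (E1 * G z + F z * E2 + (F (z + w)%C - F z) * (G (z + w)%C - G z))%C
  by (unfold E1, E2; ring).
pose proof (Cmod_ge_0 w) as Hw0.
eapply Rle_trans; [apply Cmod_triangle|].
eapply Rle_trans; [apply Rplus_le_compat_r, Cmod_triangle|].
rewrite !Cmod_mult.
assert (T1 : Cmod E1 * Cmod (G z) <= eps / 3 * Cmod w).
{ apply Rle_trans with (e1 * Cmod w * (Cmod (G z) + 1)).
  - apply Rmult_le_compat; [apply Cmod_ge_0 | easy | exact H3 | lra].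
  - right. unfold e1. field. lra. }
assert (T2 : Cmod (F z) * Cmod E2 <= eps / 3 * Cmod w).
{ apply Rle_trans with ((Cmod (F z) + 1) * (e2 * Cmod w)).
  - apply Rmult_le_compat; [easy | apply Cmod_ge_0 | lra | exact H4].
  - right. unfold e2. field. lra. }
assert (T3 : Cmod (F (z + w)%C - F z) * Cmod (G (z + w)%C - G z) <= eps / 3 * Cmod w).
{ apply Rle_trans with (L1 * Cmod w * (L2 * Cmod w)).
  - apply Rmult_le_compat; try apply Cmod_ge_0; assumption.
  - replace (L1 * Cmod w * (L2 * Cmod w)) with (Cmod w * (L1 * L2) * Cmod w) by ring.
    apply Rmult_le_compat_r; [exact Hw0|].
    apply Rle_trans with (d5 * (L1 * L2)); [apply Rmult_le_compat_r; lra|].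
    right. unfold d5. field. lra. }
lra.
Qed.

Lemma Cmod_pow_even (z : C) (j : nat) :
  RtoC (Cmod z ^ (2 * j)) = ((z * Cconj z) ^ j)%C.
Proof. rewrite <- Cmod2_conj, <- RtoC_pow, pow_mult. reflexivity. Qed.

(** The two derivatives are the same multiple of conj z and of z: this is what
    makes z F_z - conj z F_zbar vanish on functions of the modulus. *)
Lemma wirtinger_mod_pow (j : nat) (z : C) :
  let c := RtoC (INR j * Cmod z ^ (2 * pred j)) in
  wirtinger (fun z => RtoC (Cmod z ^ (2 * j))) z (c * Cconj z) (c * z).
Proof.
assert (H : wirtinger (fun z => z * Cconj z)%C z (Cconj z) z).
{ eapply wirtinger_eq;
    [exact (wirtinger_mult _ _ _ _ _ _ _ (wirtinger_id z)
              (wirtinger_Cconj _ _ _ _ (wirtinger_id z)))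
    | |]; apply injective_projections; simpl; ring. }
induction j as [|j IH]; intros c.
- apply wirtinger_eq with (RtoC 0) (RtoC 0); [exact (wirtinger_const (RtoC 1) z)| |];
    unfold c; simpl INR; rewrite Rmult_0_l; ring.
- assert (Ec : c = (RtoC (INR j * Cmod z ^ (2 * pred j)) * (z * Cconj z)
                    + RtoC (Cmod z ^ (2 * j)))%C).
  { unfold c. rewrite <- Cmod2_conj, <- RtoC_mult, <- RtoC_plus, S_INR.
    destruct j as [|j]; simpl pred; [simpl; f_equal; ring|].
    replace (2 * S j)%nat with (2 * j + 2)%nat by lia. rewrite pow_add.
    f_equal. ring. }
  eapply wirtinger_eq;
    [apply wirtinger_ext_disk
       with (F := fun z => (RtoC (Cmod z ^ (2 * j)) * (z * Cconj z))%C) (r := Cmod z + 1);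
     [unfold disk; lra | | exact (wirtinger_mult _ _ _ _ _ _ _ IH H)] | |].
  + intros w _. rewrite !Cmod_pow_even, Cpow_S. ring.
  + rewrite Ec. cbv beta. ring.
  + rewrite Ec. cbv beta. ring.
Qed.

Lemma wirtinger_sum (f : nat -> C -> C) (p q : nat -> C) (z : C) (m : nat) :
  (forall k, (1 <= k <= m)%nat -> wirtinger (f k) z (p k) (q k)) ->
  wirtinger (fun z => sum_n_m (fun k => f k z) 1 m) z (sum_n_m p 1 m) (sum_n_m q 1 m).
Proof.
induction m as [|m IH]; intros H.
- rewrite !Csum_0. apply wirtinger_ext_disk with (F := fun _ => RtoC 0) (r := Cmod z + 1);
    [unfold disk; lra | | apply wirtinger_const].
  intros w _. now rewrite Csum_0.
- rewrite !Csum_S.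
  apply wirtinger_ext_disk
    with (F := fun z => (sum_n_m (fun k => f k z) 1 m + f (S m) z)%C) (r := Cmod z + 1);
    [unfold disk; lra | |].
  + intros w _. now rewrite Csum_S.
  + apply wirtinger_plus; [apply IH; intros; apply H; lia | apply H; lia].
Qed.

(** * Powers and power series *)

(** The defect from the value of the full series is kept in closed form, which
    turns the induction into an identity. *)
Lemma sum_n_succ_geom_le (r : R) (N : nat) : 0 <= r < 1 ->
  sum_n (fun m => INR (S m) * r ^ m) N <= 1 / (1 - r) ^ 2.
Proof.
intros Hr.
assert (E : sum_n (fun m => INR (S m) * r ^ m) N * (1 - r) ^ 2
            = 1 - r ^ S N * (INR (S (S N)) - INR (S N) * r)).
{ induction N as [|N IH]; [rewrite sum_O; simpl; ring|].
  rewrite sum_Sn. change plus with Rplus. rewrite Rmult_plus_distr_r, IH.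
  rewrite !S_INR. simpl. ring. }
apply Rmult_le_reg_r with ((1 - r) ^ 2); [apply pow_lt; lra|].
rewrite E. replace (1 / (1 - r) ^ 2 * (1 - r) ^ 2) with 1 by (field; lra).
assert (0 <= r ^ S N * (INR (S (S N)) - INR (S N) * r)).
{ apply Rmult_le_pos; [apply pow_le; lra|].
  rewrite (S_INR (S N)). pose proof (pos_INR (S N)). nra. }
lra.
Qed.

Lemma sum_n_sqr_succ_geom_le (r : R) (N : nat) : 0 <= r < 1 ->
  sum_n (fun m => INR (S m) ^ 2 * r ^ m) N <= (1 + r) / (1 - r) ^ 3.
Proof.
intros Hr.
assert (E : sum_n (fun m => INR (S m) ^ 2 * r ^ m) N * (1 - r) ^ 3
            = 1 + r - r ^ S N * ((INR (S (S N)) - INR (S N) * r) ^ 2 + r)).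
{ induction N as [|N IH]; [rewrite sum_O; simpl; ring|].
  rewrite sum_Sn. change plus with Rplus. rewrite Rmult_plus_distr_r, IH.
  rewrite !S_INR. simpl. ring. }
apply Rmult_le_reg_r with ((1 - r) ^ 3); [apply pow_lt; lra|].
rewrite E. replace ((1 + r) / (1 - r) ^ 3 * (1 - r) ^ 3) with (1 + r) by (field; lra).
assert (0 <= r ^ S N * ((INR (S (S N)) - INR (S N) * r) ^ 2 + r)).
{ apply Rmult_le_pos; [apply pow_le; lra|].
  pose proof (pow2_ge_0 (INR (S (S N)) - INR (S N) * r)). lra. }
lra.
Qed.

Lemma Cmod_pow_le (z : C) (r : R) (n : nat) : Cmod z <= r -> Cmod (z ^ n) <= r ^ n.
Proof. intros H. rewrite Cmod_pow. apply pow_incr. split; [apply Cmod_ge_0 | easy]. Qed.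

Lemma Cmod_mult_diff_le (a b c d : C) (A D : R) :
  Cmod a <= A -> Cmod d <= D ->
  Cmod (a * b - c * d) <= A * Cmod (b - d) + D * Cmod (a - c).
Proof.
intros Ha Hd.
replace (a * b - c * d)%C with (a * (b - d) + d * (a - c))%C by ring.
eapply Rle_trans; [apply Cmod_triangle|]. rewrite !Cmod_mult.
apply Rplus_le_compat; apply Rmult_le_compat_r; (apply Cmod_ge_0 || easy).
Qed.

Lemma Cpow_lipschitz (z w : C) (r : R) (n : nat) : Cmod z <= r -> Cmod w <= r ->
  Cmod (z ^ n - w ^ n) <= INR n * r ^ pred n * Cmod (z - w).
Proof.
intros Hz Hw. induction n as [|n IH].
- simpl. replace (1 - 1)%C with (RtoC 0) by ring. rewrite Cmod_0. lra.
- rewrite !Cpow_S.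
  eapply Rle_trans;
    [apply Cmod_mult_diff_le; [exact Hz | exact (Cmod_pow_le w r n Hw)]|].
  assert (Hr : 0 <= r) by (pose proof (Cmod_ge_0 z); lra).
  apply Rle_trans with (r * (INR n * r ^ pred n * Cmod (z - w)) + r ^ n * Cmod (z - w)).
  + apply Rplus_le_compat_r, Rmult_le_compat_l; [exact Hr | exact IH].
  + right. rewrite S_INR. destruct n as [|n]; simpl; [|rewrite ?S_INR]; ring.
Qed.

(** The factor r^2 replaces the exponent n - 2 of the usual second-order bound,
    which would need separate cases for n = 0 and n = 1. *)
Lemma Cpow_remainder (z w : C) (r : R) (n : nat) :
  Cmod z <= r -> Cmod (z + w) <= r ->
  Cmod ((z + w) ^ n - z ^ n - RtoC (INR n) * z ^ pred n * w) * r ^ 2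
  <= INR n ^ 2 * r ^ n * Cmod w ^ 2.
Proof.
intros Hz Hzw. assert (Hr : 0 <= r) by (pose proof (Cmod_ge_0 z); lra).
induction n as [|n IH].
- simpl. replace (1 - 1 - 0 * 1 * w)%C with (RtoC 0) by ring. rewrite Cmod_0. lra.
- set (D := ((z + w) ^ n - z ^ n - RtoC (INR n) * z ^ pred n * w)%C) in IH.
  replace ((z + w) ^ S n - z ^ S n - RtoC (INR (S n)) * z ^ pred (S n) * w)%C
    with ((z + w) * D + RtoC (INR n) * z ^ pred n * (w * w))%C.
  2:{ unfold D. rewrite S_INR, RtoC_plus. destruct n as [|n]; simpl; ring. }
  apply Rle_trans with
    ((r * Cmod D + INR n * r ^ pred n * Cmod w ^ 2) * r ^ 2).
  + apply Rmult_le_compat_r; [apply pow2_ge_0|].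
    eapply Rle_trans; [apply Cmod_triangle|]. rewrite !Cmod_mult, Cmod_R.
    rewrite (Rabs_pos_eq (INR n)) by apply pos_INR.
    apply Rplus_le_compat; [apply Rmult_le_compat_r; [apply Cmod_ge_0 | exact Hzw]|].
    replace (Cmod w * Cmod w) with (Cmod w ^ 2) by ring.
    apply Rmult_le_compat_r; [apply pow2_ge_0|].
    apply Rmult_le_compat_l; [apply pos_INR | now apply Cmod_pow_le].
  + apply Rle_trans with (r * (INR n ^ 2 * r ^ n * Cmod w ^ 2)
      + INR n * r ^ S n * Cmod w ^ 2).
    * rewrite Rmult_plus_distr_r. apply Rplus_le_compat.
      -- rewrite Rmult_assoc. apply Rmult_le_compat_l; [exact Hr | exact IH].
      -- right. destruct n as [|n]; simpl; ring.
    * rewrite S_INR. simpl.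
      assert (H : 0 <= r * r ^ n * (Cmod w * (Cmod w * 1)) * (INR n + 1)).
      { pose proof (pow_le r n Hr). pose proof (Cmod_ge_0 w). pose proof (pos_INR n).
        repeat apply Rmult_le_pos; lra. }
      nra.
Qed.

(** Indexed so that [al m] is the coefficient of the power m + 1; thus this is the
    derivative of the series without constant term. *)
Definition power_series_derivative (al : nat -> C) (z : C) : C :=
  CSeries (fun m => RtoC (INR (S m)) * al m * z ^ m)%C.

Lemma is_series_derivative (al : nat -> C) (B : R) (z : C) :
  (forall m, Cmod (al m) <= B) -> disk 1 z ->
  is_series (fun m => RtoC (INR (S m)) * al m * z ^ m)%C (power_series_derivative al z).
Proof.
unfold disk. intros HB Hz.
apply CSeries_correct with (fun m => B * (INR (S m) * Cmod z ^ m)) (B * (1 / (1 - Cmod z) ^ 2)).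
- intros m. rewrite !Cmod_mult, Cmod_R, Cmod_pow, Rabs_pos_eq by apply pos_INR.
  replace (INR (S m) * Cmod (al m) * Cmod z ^ m)
    with (Cmod (al m) * (INR (S m) * Cmod z ^ m)) by ring.
  apply Rmult_le_compat_r; [|apply HB].
  apply Rmult_le_pos; [apply pos_INR | apply pow_le, Cmod_ge_0].
- intros N. rewrite sum_n_Rmult_l.
  apply Rmult_le_compat_l; [eapply Rle_trans; [apply Cmod_ge_0 | apply (HB 0%nat)]|].
  apply sum_n_succ_geom_le. split; [apply Cmod_ge_0 | exact Hz].
Qed.

(** Summing the second-order remainders of the monomials gives a remainder of
    size O(|w|^2). *)
Lemma wirtinger_power_series (al : nat -> C) (B : R) (H : C -> C) (z : C) :
  (forall m, Cmod (al m) <= B) ->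
  (forall w, disk 1 w -> is_series (fun m => al m * w ^ S m)%C (H w)) ->
  disk 1 z ->
  wirtinger H z (power_series_derivative al z) 0%C.
Proof.
intros HB HH Hz. pose proof (is_series_derivative al B z HB Hz) as HD.
assert (Hz' := Hz). unfold disk in Hz'.
pose proof (Cmod_ge_0 z) as Hz0.
set (r := (Cmod z + 1) / 2).
assert (Hr : 0 < r < 1) by (unfold r; lra).
assert (HB0 : 0 <= B) by (eapply Rle_trans; [apply Cmod_ge_0 | apply (HB 0%nat)]).
set (K := B / r * ((1 + r) / (1 - r) ^ 3)).
assert (HK : 0 <= K).
{ unfold K. apply Rmult_le_pos; apply Rdiv_le_0_compat; try lra.
  apply pow_lt. lra. }
intros eps He. exists (Rmin ((1 - Cmod z) / 2) (eps / (K + 1))).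
split; [apply Rmin_pos; [lra | apply Rdiv_lt_0_compat; lra]|].
intros w Hw.
pose proof (Rlt_le_trans _ _ _ Hw (Rmin_l _ _)) as H1.
pose proof (Rlt_le_trans _ _ _ Hw (Rmin_r _ _)) as H2.
pose proof (Cmod_triangle z w) as H3.
assert (Hzw : disk 1 (z + w)%C) by (unfold disk; lra).
pose proof (is_series_Cminus _ _ _ _ (is_series_Cminus _ _ _ _ (HH _ Hzw) (HH _ Hz))
  (is_series_Cmult w _ _ HD)) as HS.
replace (H (z + w)%C - H z - (power_series_derivative al z * w + 0 * Cconj w))%C
  with (H (z + w)%C - H z - w * power_series_derivative al z)%C by ring.
assert (Hfin : Cmod (H (z + w)%C - H z - w * power_series_derivative al z)
  <= K * Cmod w ^ 2).
{ apply is_series_Cmod_le with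
    (b := fun m => B / r * Cmod w ^ 2 * (INR (S m) ^ 2 * r ^ m)) (1 := HS).
  - intros m.
    replace (al m * (z + w) ^ S m - al m * z ^ S m
             - w * (RtoC (INR (S m)) * al m * z ^ m))%C
      with (al m * ((z + w) ^ S m - z ^ S m - RtoC (INR (S m)) * z ^ pred (S m) * w))%C
      by (cbn [Nat.pred]; ring).
    rewrite Cmod_mult.
    assert (Hp := Cpow_remainder z w r (S m) ltac:(unfold r; lra) ltac:(unfold r; lra)).
    set (X := Cmod ((z + w) ^ S m - z ^ S m - RtoC (INR (S m)) * z ^ pred (S m) * w)) in *.
    assert (HX : X <= / r * Cmod w ^ 2 * (INR (S m) ^ 2 * r ^ m)).
    { apply Rmult_le_reg_r with (r ^ 2); [apply pow_lt; lra|].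
      eapply Rle_trans; [exact Hp|]. right. simpl. field. lra. }
    apply Rle_trans with (B * (/ r * Cmod w ^ 2 * (INR (S m) ^ 2 * r ^ m))).
    + apply Rmult_le_compat; [apply Cmod_ge_0 | apply Cmod_ge_0 | apply HB | exact HX].
    + right. unfold Rdiv. ring.
  - intros N. rewrite sum_n_Rmult_l. unfold K.
    replace (B / r * ((1 + r) / (1 - r) ^ 3) * Cmod w ^ 2)
      with (B / r * Cmod w ^ 2 * ((1 + r) / (1 - r) ^ 3)) by ring.
    apply Rmult_le_compat_l; [|apply sum_n_sqr_succ_geom_le; lra].
    apply Rmult_le_pos; [apply Rdiv_le_0_compat; lra | apply pow2_ge_0]. }
eapply Rle_trans; [exact Hfin|].
replace (K * Cmod w ^ 2) with (K * Cmod w * Cmod w) by ring.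
apply Rmult_le_compat_r; [apply Cmod_ge_0|].
apply Rle_trans with ((K + 1) * (eps / (K + 1))); [|right; field; lra].
pose proof (Cmod_ge_0 w). apply Rmult_le_compat; lra.
Qed.

(** * Lipschitz constants of harmonic series times powers of the modulus *)

(** The term of degree m + 1, because the series have no constant term. *)
Definition harmonic_term (al be : nat -> C) (z : C) (m : nat) : C :=
  (al m * z ^ S m + Cconj (be m * z ^ S m))%C.

Lemma Cmod_harmonic_combination (a b u : C) :
  Cmod (a * u + Cconj (b * u)) <= (Cmod a + Cmod b) * Cmod u.
Proof.
eapply Rle_trans; [apply Cmod_triangle|]. rewrite Cmod_conj, !Cmod_mult. lra.
Qed.

(** The weight [b] is the coefficient bound after division by the factor m + 1
    which L produces; it is not constant because the linear term has to be left
    out when j = 0. *)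
Lemma harmonic_size (al be : nat -> C) (b : nat -> R) (V z : C) (j : nat) (r E : R) :
  is_series (harmonic_term al be z) V ->
  (forall m, Cmod (al m) + Cmod (be m) <= INR (S m) * b m) ->
  Cmod z <= r ->
  (forall N, sum_n (fun m => b m * (INR (S m) * r ^ (2 * j + m))) N <= E) ->
  Cmod (RtoC (Cmod z ^ (2 * j)) * V) <= E * Cmod z.
Proof.
intros HV Hab Hz HE.
apply is_series_Cmod_le with
  (b := fun m => Cmod z * (b m * (INR (S m) * r ^ (2 * j + m))))
  (1 := is_series_Cmult (RtoC (Cmod z ^ (2 * j))) _ _ HV).
- intros m. unfold harmonic_term. rewrite Cmod_mult, Cmod_R.
  pose proof (Cmod_ge_0 z) as Hz0.
  rewrite Rabs_pos_eq by (apply pow_le; exact Hz0).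
  apply Rle_trans with (Cmod z ^ (2 * j) * (INR (S m) * b m * Cmod z ^ S m)).
  + apply Rmult_le_compat_l; [apply pow_le; exact Hz0|].
    eapply Rle_trans; [apply Cmod_harmonic_combination|].
    rewrite Cmod_pow. apply Rmult_le_compat_r; [apply pow_le; exact Hz0 | apply Hab].
  + replace (Cmod z ^ (2 * j) * (INR (S m) * b m * Cmod z ^ S m))
      with (Cmod z * (INR (S m) * b m) * Cmod z ^ (2 * j + m))
      by (rewrite pow_add, <- tech_pow_Rmult; ring).
    replace (Cmod z * (b m * (INR (S m) * r ^ (2 * j + m))))
      with (Cmod z * (INR (S m) * b m) * r ^ (2 * j + m)) by ring.
    apply Rmult_le_compat_l; [|apply pow_incr; lra].
    apply Rmult_le_pos; [exact Hz0|]. eapply Rle_trans; [|apply Hab].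
    pose proof (Cmod_ge_0 (al m)). pose proof (Cmod_ge_0 (be m)). lra.
- intros N. rewrite sum_n_Rmult_l, Rmult_comm.
  apply Rmult_le_compat_r; [apply Cmod_ge_0 | apply HE].
Qed.

(** The function is the polynomial conj(z)^j z^(j+m+1), of total degree
    2j + m + 1. *)
Lemma mod_pow_mult_Cpow_lipschitz (z w : C) (r : R) (j m : nat) :
  Cmod z <= r -> Cmod w <= r ->
  Cmod (RtoC (Cmod z ^ (2 * j)) * z ^ S m - RtoC (Cmod w ^ (2 * j)) * w ^ S m)
  <= (2 * INR j + INR (S m)) * r ^ (2 * j + m) * Cmod (z - w).
Proof.
intros Hz Hw. assert (Hr : 0 <= r) by (pose proof (Cmod_ge_0 z); lra).
assert (E : forall z, (RtoC (Cmod z ^ (2 * j)) * z ^ S m)%C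
  = (Cconj z ^ j * z ^ (j + S m))%C).
{ intros u. rewrite Cmod_pow_even, Cpow_mult_l, Cpow_add_r. ring. }
rewrite !E.
assert (Hcz : Cmod (Cconj z ^ j) <= r ^ j) by (apply Cmod_pow_le; now rewrite Cmod_conj).
eapply Rle_trans;
  [apply (Cmod_mult_diff_le _ _ _ _ _ _ Hcz (Cmod_pow_le w r (j + S m) Hw))|].
pose proof (Cpow_lipschitz z w r (j + S m) Hz Hw) as H1.
pose proof (Cpow_lipschitz (Cconj z) (Cconj w) r j) as H2.
rewrite !Cmod_conj, <- Cminus_conj, Cmod_conj in H2. specialize (H2 Hz Hw).
eapply Rle_trans; [apply Rplus_le_compat; apply Rmult_le_compat_l;
  [apply pow_le; exact Hr | exact H1 | apply pow_le; exact Hr | exact H2]|].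
right. replace (pred (j + S m)) with (j + m)%nat by lia.
replace (2 * j + m)%nat with (j + (j + m))%nat by lia.
assert (Ej : INR j * (r ^ pred j * r) = INR j * r ^ j)
  by (destruct j as [|j]; simpl; ring).
rewrite plus_INR, !pow_add, <- (tech_pow_Rmult r m).
transitivity (r ^ j * ((INR j + INR (S m)) * (r ^ j * r ^ m) * Cmod (z - w))
  + r ^ j * r ^ m * Cmod (z - w) * (INR j * (r ^ pred j * r))); [ring|].
rewrite Ej. ring.
Qed.

Lemma harmonic_lipschitz (al be : nat -> C) (b : nat -> R) (V W z w : C) (j : nat)
  (r E : R) :
  is_series (harmonic_term al be z) V -> is_series (harmonic_term al be w) W ->
  (forall m, Cmod (al m) + Cmod (be m) <= INR (S m) * b m) ->
  Cmod z <= r -> Cmod w <= r ->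
  (forall N, sum_n (fun m => b m *
     (INR (S m) * (2 * INR j + INR (S m)) * r ^ (2 * j + m))) N <= E) ->
  Cmod (RtoC (Cmod z ^ (2 * j)) * V - RtoC (Cmod w ^ (2 * j)) * W) <= E * Cmod (z - w).
Proof.
intros HV HW Hab Hz Hw HE.
apply is_series_Cmod_le with
  (b := fun m => Cmod (z - w) *
     (b m * (INR (S m) * (2 * INR j + INR (S m)) * r ^ (2 * j + m))))
  (1 := is_series_Cminus _ _ _ _
     (is_series_Cmult (RtoC (Cmod z ^ (2 * j))) _ _ HV)
     (is_series_Cmult (RtoC (Cmod w ^ (2 * j))) _ _ HW)).
- intros m. unfold harmonic_term.
  set (f := fun z => (RtoC (Cmod z ^ (2 * j)) * z ^ S m)%C).
  replace (RtoC (Cmod z ^ (2 * j)) * (al m * z ^ S m + Cconj (be m * z ^ S m))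
    - RtoC (Cmod w ^ (2 * j)) * (al m * w ^ S m + Cconj (be m * w ^ S m)))%C
    with (al m * (f z - f w) + Cconj (be m * (f z - f w)))%C.
  2:{ unfold f. rewrite !Cmult_conj, Cminus_conj, !Cmult_conj.
      assert (Er : forall x : R, Cconj (RtoC x) = RtoC x)
        by (intros; apply injective_projections; simpl; ring).
      rewrite !Er. ring. }
  eapply Rle_trans; [apply Cmod_harmonic_combination|].
  pose proof (mod_pow_mult_Cpow_lipschitz z w r j m Hz Hw) as Hf.
  eapply Rle_trans; [apply Rmult_le_compat; [| apply Cmod_ge_0 | apply Hab | exact Hf]|].
  + pose proof (Cmod_ge_0 (al m)). pose proof (Cmod_ge_0 (be m)). lra.
  + right. ring.
- intros N. rewrite sum_n_Rmult_l, Rmult_comm.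
  apply Rmult_le_compat_r; [apply Cmod_ge_0 | apply HE].
Qed.

Lemma sum_n_weight_le (b w : nat -> R) (K W : R) (N : nat) :
  (forall m, b m <= K) -> 0 <= K -> (forall m, 0 <= w m) ->
  (forall N, sum_n w N <= W) -> sum_n (fun m => b m * w m) N <= K * W.
Proof.
intros Hb HK Hw HW. apply Rle_trans with (sum_n (fun m => K * w m) N).
- apply sum_n_m_le. intros m. apply Rmult_le_compat_r; [apply Hw | apply Hb].
- rewrite sum_n_Rmult_l. apply Rmult_le_compat_l; [exact HK | apply HW].
Qed.

(** A vanishing first weight saves the first term of the majorant; it is used for
    the analytic part from which the linear term has been removed. *)
Lemma sum_n_weight_tail_le (b w : nat -> R) (K W : R) (N : nat) :
  (forall m, b m <= K) -> 0 <= K -> (forall m, 0 <= w m) -> b 0%nat = 0 ->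
  (forall N, sum_n w N <= W) -> sum_n (fun m => b m * w m) N <= K * (W - w 0%nat).
Proof.
intros Hb HK Hw Hb0 HW.
apply Rle_trans with (K * (sum_n w N - w 0%nat)).
- induction N as [|N IH]; [rewrite !sum_O, Hb0; lra|].
  rewrite !sum_Sn. change plus with Rplus.
  pose proof (Rmult_le_compat_r _ _ _ (Hw (S N)) (Hb (S N))). lra.
- apply Rmult_le_compat_l; [exact HK|]. specialize (HW N). lra.
Qed.

(** * Points of the unit circle *)

Definition cis (t : R) : C := (cos t, sin t).

Lemma cis_plus (s t : R) : cis (s + t) = (cis s * cis t)%C.
Proof.
apply injective_projections; simpl; [rewrite cos_plus | rewrite sin_plus]; ring.
Qed.

Lemma cis_0 : cis 0 = RtoC 1.
Proof. unfold cis. now rewrite cos_0, sin_0. Qed.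

Lemma Cmod_cis (t : R) : Cmod (cis t) = 1.
Proof.
unfold Cmod, cis; simpl. replace (_ + _) with 1; [apply sqrt_1|].
pose proof (sin2_cos2 t) as H. unfold Rsqr in H. lra.
Qed.

Lemma Cconj_cis (t : R) : Cconj (cis t) = cis (- t).
Proof. unfold cis. rewrite cos_neg, sin_neg. reflexivity. Qed.

Lemma cis_pow (t : R) (n : nat) : (cis t ^ n)%C = cis (INR n * t).
Proof.
induction n as [|n IH]; [simpl; now rewrite Rmult_0_l, cis_0|].
rewrite Cpow_S, IH, <- cis_plus, S_INR. f_equal. ring.
Qed.

Lemma cis_2PI (d : Z) : cis (2 * (IZR d * PI)) = RtoC 1.
Proof.
unfold cis. assert (H : sin (IZR d * PI) = 0) by (apply sin_eq_0_1; now exists d).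
rewrite cos_2a_sin, sin_2a, H. apply injective_projections; simpl; ring.
Qed.

Lemma cis_neq_1 (t : R) : 0 < Rabs t < PI -> cis (2 * t) <> RtoC 1.
Proof.
intros Ht E. apply (f_equal fst) in E. simpl in E.
rewrite cos_2a_sin in E.
assert (H : sin t <> 0).
{ unfold Rabs in Ht. destruct (Rcase_abs t).
  - pose proof (sin_gt_0 (- t)) as H. rewrite sin_neg in H. lra.
  - pose proof (sin_gt_0 t). lra. }
apply H. nra.
Qed.

(** * Parseval identity over roots of unity *)

(** The nodes are the S M equally spaced arguments; [freq M d] samples the
    character of frequency d at them. *)
Definition node (M j : nat) : R := 2 * PI * INR j / INR (S M).

Definition freq (M : nat) (d : Z) (j : nat) : C := cis (IZR d * node M j).

Lemma freq_mult (M : nat) (d d' : Z) (j : nat) :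
  (freq M d j * freq M d' j)%C = freq M (d + d') j.
Proof. unfold freq. rewrite <- cis_plus, plus_IZR. f_equal. ring. Qed.

Lemma freq_conj (M : nat) (d : Z) (j : nat) :
  Cconj (freq M d j) = freq M (- d) j.
Proof. unfold freq. rewrite Cconj_cis, opp_IZR. f_equal. ring. Qed.

Lemma sum_n_Cmult_l (c : C) (u : nat -> C) (N : nat) :
  (sum_n (fun j => (c * u j)%C) N : C) = (c * sum_n u N)%C.
Proof. exact (sum_n_mult_l (K := C_Ring) c u N). Qed.

Lemma sum_n_Cext (u v : nat -> C) (N : nat) :
  (forall j, u j = v j) -> (sum_n u N : C) = sum_n v N.
Proof. exact (sum_n_ext u v N). Qed.

Lemma sum_n_Rext (u v : nat -> R) (N : nat) :
  (forall j, u j = v j) -> (sum_n u N : R) = sum_n v N.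
Proof. exact (sum_n_ext u v N). Qed.

Lemma sum_n_Rplus (u v : nat -> R) (N : nat) :
  (sum_n (fun j => u j + v j) N : R) = sum_n u N + sum_n v N.
Proof. exact (sum_n_plus u v N). Qed.

Lemma sum_n_Cplus (u v : nat -> C) (N : nat) :
  (sum_n (fun j => (u j + v j)%C) N : C) = (sum_n u N + sum_n v N)%C.
Proof. exact (sum_n_plus u v N). Qed.

(** A geometric sum whose ratio is a root of unity different from 1. *)
Lemma sum_n_freq (M : nat) (d : Z) : (0 < Z.abs d < Z.of_nat (S M))%Z ->
  (sum_n (freq M d) M : C) = RtoC 0.
Proof.
intros Hd. pose proof PI_RGT_0 as Hpi.
assert (HM : 0 < INR (S M)) by (apply lt_0_INR; lia).
set (t := IZR d * PI / INR (S M)).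
assert (Ex : forall j, freq M d j = (cis (2 * t) ^ j)%C).
{ intros j. rewrite cis_pow. unfold freq, node, t. f_equal. field. lra. }
assert (Hne : cis (2 * t) <> RtoC 1).
{ apply cis_neq_1. unfold t, Rdiv.
  rewrite !Rabs_mult, Rabs_inv, (Rabs_pos_eq PI), (Rabs_pos_eq (INR (S M))) by lra.
  rewrite <- abs_IZR.
  assert (H1 : 0 < IZR (Z.abs d)) by (apply IZR_lt; lia).
  assert (H2 : IZR (Z.abs d) < INR (S M)) by (rewrite INR_IZR_INZ; apply IZR_lt; lia).
  pose proof (Rinv_0_lt_compat _ HM) as H3.
  split; [apply Rmult_lt_0_compat; [apply Rmult_lt_0_compat|]; lra|].
  apply Rmult_lt_reg_r with (INR (S M)); [exact HM|].
  rewrite Rmult_assoc, Rinv_l by lra. nra. }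
set (x := cis (2 * t)) in *.
rewrite (sum_n_ext _ (fun j => (x ^ j)%C) M Ex).
assert (Eg : forall N, ((x - 1) * sum_n (fun j => (x ^ j)%C) N)%C = (x ^ S N - 1)%C).
{ induction N as [|N IH]; [rewrite sum_O; simpl; ring|].
  rewrite sum_Sn.
  change (((x - 1) * (sum_n (fun j => (x ^ j)%C) N + x ^ S N))%C = (x ^ S (S N) - 1)%C).
  rewrite Cmult_plus_distr_l, IH. simpl. ring. }
specialize (Eg M).
replace (x ^ S M)%C with (RtoC 1) in Eg.
2:{ unfold x, t. rewrite cis_pow, <- (cis_2PI d). f_equal. field. lra. }
assert (Hx : (x - 1)%C <> RtoC 0).
{ intros E. apply Hne. replace x with (x - 1 + 1)%C by ring. rewrite E. ring. }
set (u := sum_n (fun j => (x ^ j)%C) M : C) in *.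
replace u with (/ (x - 1) * ((x - 1) * u))%C by (field; exact Hx).
rewrite Eg. ring.
Qed.

(** The values of the characters are abstracted as [e], so that the same
    polynomial can be evaluated at the nodes and at an arbitrary argument. *)
Definition trig_poly (A B : nat -> C) (N : nat) (e : Z -> C) : C :=
  sum_n_m (fun n => A n * e (Z.of_nat n) + B n * e (- Z.of_nat n)%Z)%C 1 N.

Lemma trig_poly_S (A B : nat -> C) (N : nat) (e : Z -> C) :
  trig_poly A B (S N) e = (trig_poly A B N e
    + (A (S N) * e (Z.of_nat (S N)) + B (S N) * e (- Z.of_nat (S N))%Z))%C.
Proof. unfold trig_poly. rewrite sum_n_Sm by lia. reflexivity. Qed.

(** The frequencies d + s with |d| <= N stay nonzero and below the number of
    nodes in absolute value, so no aliasing occurs. *)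
Lemma trig_poly_orthogonal (A B : nat -> C) (M N : nat) (s : Z) :
  (Z.of_nat N < Z.abs s)%Z -> (Z.of_nat N + Z.abs s < Z.of_nat (S M))%Z ->
  (sum_n (fun j => (trig_poly A B N (fun d => freq M d j) * freq M s j)%C) M : C)
  = RtoC 0.
Proof.
induction N as [|N IH]; intros H1 H2.
- rewrite (sum_n_Cext _ (fun j => (RtoC 0 * freq M s j)%C)).
  + rewrite sum_n_Cmult_l. ring.
  + intros j. unfold trig_poly. now rewrite sum_n_m_zero by lia.
- rewrite (sum_n_Cext _ (fun j =>
    (trig_poly A B N (fun d => freq M d j) * freq M s j
     + (A (S N) * freq M (Z.of_nat (S N) + s) j
        + B (S N) * freq M (- Z.of_nat (S N) + s) j))%C)).
  + rewrite !sum_n_Cplus, !sum_n_Cmult_l, IH, !sum_n_freq by lia. ring.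
  + intros j. rewrite trig_poly_S, <- !freq_mult. ring.
Qed.

Lemma Cmod2_plus (x y : C) :
  Cmod (x + y) ^ 2 = Cmod x ^ 2 + Cmod y ^ 2 + 2 * Re (x * Cconj y).
Proof. rewrite !Cmod2_alt. unfold Re, Im. simpl. ring. Qed.

Lemma trig_poly_parseval (A B : nat -> C) (M N : nat) : (2 * N < S M)%nat ->
  (sum_n (fun j => Cmod (trig_poly A B N (fun d => freq M d j)) ^ 2) M : R)
  = INR (S M) * sum_n_m (fun n => Cmod (A n) ^ 2 + Cmod (B n) ^ 2) 1 N.
Proof.
induction N as [|N IH]; intros H.
- rewrite sum_n_m_zero by lia. change zero with 0.
  rewrite (sum_n_Rext _ (fun _ => 0)).
  + rewrite sum_n_const. ring.
  + intros j. unfold trig_poly. rewrite sum_n_m_zero by lia.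
    change zero with (RtoC 0). rewrite Cmod_0. ring.
- set (a := A (S N)). set (b := B (S N)). set (d := Z.of_nat (S N)).
  set (T := fun j => trig_poly A B N (fun d => freq M d j)).
  rewrite (sum_n_Rext _ (fun j => (Cmod (T j) ^ 2 + (Cmod a ^ 2 + Cmod b ^ 2))
    + 2 * Re (Cconj a * (T j * freq M (- d) j) + Cconj b * (T j * freq M d j)
              + a * Cconj b * freq M (d + d) j))).
  + rewrite sum_n_Sm by lia.
    rewrite !sum_n_Rplus, !sum_n_const.
    rewrite sum_n_Rmult_l, <- sum_n_Re.
    rewrite !sum_n_Cplus, !sum_n_Cmult_l.
    unfold T at 1. rewrite IH by lia.
    unfold T. rewrite !trig_poly_orthogonal, sum_n_freq by (unfold d; lia).
    replace (Re _) with 0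
      by (unfold Re; simpl; ring).
    change plus with Rplus. fold a b. ring.
  + intros j. rewrite trig_poly_S. fold a b d. fold (T j).
    rewrite Cmod2_plus, Cmod2_plus, !Cmod_mult.
    replace (Cmod (freq M d j)) with 1 by (symmetry; apply Cmod_cis).
    replace (Cmod (freq M (- d) j)) with 1 by (symmetry; apply Cmod_cis).
    rewrite Cplus_conj, !Cmult_conj, !freq_conj, Z.opp_involutive.
    rewrite <- (freq_mult M d d). unfold Re. simpl. ring.
Qed.

(** Averaging over more than 2N nodes is exact for products of two such
    polynomials, so that finite sums replace the integral over the circle. *)
Lemma bessel_circle (A B : nat -> C) (N : nat) (M : R) :
  (forall t, Cmod (trig_poly A B N (fun d => cis (IZR d * t))) <= M) ->
  sum_n_m (fun n => Cmod (A n) ^ 2 + Cmod (B n) ^ 2) 1 N <= M ^ 2.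
Proof.
intros H. set (m := (2 * N)%nat).
assert (Hm : 0 < INR (S m)) by (apply lt_0_INR; lia).
apply Rmult_le_reg_l with (INR (S m)); [exact Hm|].
rewrite <- trig_poly_parseval by (unfold m; lia).
rewrite <- sum_n_const. apply sum_n_m_le. intros j.
apply pow_incr. split; [apply Cmod_ge_0 | apply H].
Qed.

(** * Uniform truncation of power series *)

(** Convergence at a point of modulus rho in (r,1) bounds the coefficients by a
    multiple of rho^(-m), hence the tail on |z| <= r by a geometric series of
    ratio r / rho. *)
Lemma power_series_uniform_truncation (al : nat -> C) (H : C -> C) (r eps : R) :
  (forall z, disk 1 z -> is_series (fun m => al m * z ^ S m)%C (H z)) ->
  0 < r < 1 -> 0 < eps ->
  exists N0, forall N, (N0 <= N)%nat -> forall z, Cmod z <= r ->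
    Cmod (H z - sum_n (fun m => al m * z ^ S m)%C N) <= eps.
Proof.
intros HH Hr He. set (rho := (1 + r) / 2).
assert (Hrho : r < rho < 1) by (unfold rho; lra).
assert (HD : disk 1 (RtoC rho)).
{ unfold disk. rewrite Cmod_R, Rabs_pos_eq; lra. }
destruct (filterlim_bounded (K := C_AbsRing) (V := C_NormedModule)
  (sum_n (fun m => al m * RtoC rho ^ S m)%C) (ex_intro _ _ (HH _ HD))) as [K HK].
assert (HK' : forall N, Cmod (sum_n (fun m => al m * RtoC rho ^ S m)%C N) <= K)
  by (intros N; exact (HK N)).
assert (HK0 : 0 <= K) by (eapply Rle_trans; [apply Cmod_ge_0 | apply (HK' 0%nat)]).
assert (Hal : forall m, Cmod (al m) * rho ^ S m <= 2 * K).
{ intros m. replace (Cmod (al m) * rho ^ S m) with (Cmod (al m * RtoC rho ^ S m)).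
  2:{ rewrite Cmod_mult, Cmod_pow, Cmod_R, (Rabs_pos_eq rho) by lra. reflexivity. }
  destruct m as [|m].
  - specialize (HK' 0%nat). rewrite sum_O in HK'. lra.
  - pose proof (HK' m) as H1. pose proof (HK' (S m)) as H2.
    rewrite sum_Sn in H2.
    set (s := sum_n (fun m => al m * RtoC rho ^ S m)%C m) in *.
    change (Cmod (s + al (S m) * RtoC rho ^ S (S m)) <= K) in H2.
    replace (al (S m) * RtoC rho ^ S (S m))%C
      with ((s + al (S m) * RtoC rho ^ S (S m)) - s)%C by ring.
    eapply Rle_trans; [apply Cmod_triangle_minus|]. lra. }
set (q := r / rho).
assert (Hq : 0 < q < 1).
{ unfold q. split; [apply Rdiv_lt_0_compat; lra|].
  apply Rmult_lt_reg_r with rho; [lra|]. unfold Rdiv. rewrite Rmult_assoc, Rinv_l; lra. }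
assert (Hterm : forall z m, Cmod z <= r -> Cmod (al m * z ^ S m) <= 2 * K * q ^ S m).
{ intros z m Hz. rewrite Cmod_mult.
  apply Rle_trans with (Cmod (al m) * r ^ S m).
  - apply Rmult_le_compat_l; [apply Cmod_ge_0 | now apply Cmod_pow_le].
  - replace (r ^ S m) with (rho ^ S m * q ^ S m).
    + rewrite <- Rmult_assoc. apply Rmult_le_compat_r; [apply pow_le; lra | apply Hal].
    + rewrite <- Rpow_mult_distr. f_equal. unfold q. field. lra. }
set (K' := 2 * K * / (1 - q) + 1).
assert (HK'' : 0 < K').
{ unfold K'. assert (0 <= 2 * K * / (1 - q)).
  { apply Rmult_le_pos; [lra|]. left. apply Rinv_0_lt_compat. lra. } lra. }
destruct (pow_lt_1_zero q) with (y := eps / K') as [N0 HN0];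
  [rewrite Rabs_pos_eq; lra | now apply Rdiv_lt_0_compat |].
exists N0. intros N HN z Hz.
assert (Htail : is_series (fun m => al (S N + m)%nat * z ^ S (S N + m))%C
  (H z - sum_n (fun m => al m * z ^ S m)%C N)%C).
{ apply (is_series_incr_n (fun m => al m * z ^ S m)%C (S N)); [lia|].
  simpl Init.Nat.pred.
  replace (plus _ _) with (H z); [apply HH; unfold disk; lra|].
  change (H z = (H z - sum_n (fun m => al m * z ^ S m)%C N
    + sum_n (fun m => al m * z ^ S m)%C N)%C). ring. }
apply Rle_trans with (q ^ S N * K').
- apply is_series_Cmod_le with (b := fun m => q ^ S N * (2 * K) * q ^ m) (1 := Htail).
  + intros m. eapply Rle_trans; [now apply Hterm|].
    replace (S (S N + m)) with (S N + m + 1)%nat by lia. rewrite !pow_add.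
    assert (Hp : 0 <= q ^ S N * (2 * K) * q ^ m).
    { apply Rmult_le_pos; [apply Rmult_le_pos|]; try (apply pow_le; lra). lra. }
    replace (2 * K * (q ^ S N * q ^ m * q ^ 1)) with (q ^ S N * (2 * K) * q ^ m * q)
      by ring. nra.
  + intros n. rewrite sum_n_Rmult_l, Rmult_assoc.
    apply Rmult_le_compat_l; [apply pow_le; lra|].
    unfold K'. apply Rle_trans with (2 * K * / (1 - q)); [|lra].
    apply Rmult_le_compat_l; [lra|]. apply sum_n_geom_le. lra.
- specialize (HN0 (S N) ltac:(lia)). rewrite Rabs_pos_eq in HN0 by (apply pow_le; lra).
  apply Rle_trans with (eps / K' * K'); [|right; field; lra].
  apply Rmult_le_compat_r; lra.
Qed.

(** * Coefficients with acute mutual angles *)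

Lemma Carg_acute (z w : C) : z <> RtoC 0 -> w <> RtoC 0 ->
  Rabs (Carg (z / w)) <= PI / 2 -> 0 <= Re (z * Cconj w).
Proof.
intros Hz Hw H.
assert (Hzw : (z / w)%C <> RtoC 0).
{ intros E. apply Hz. replace z with (z / w * w)%C by (field; exact Hw).
  rewrite E. ring. }
destruct (Carg_spec _ Hzw) as [_ E].
assert (Hre : 0 <= Re (z / w)).
{ rewrite E. unfold Re. cbn [fst]. apply Rmult_le_pos; [apply Cmod_ge_0|].
  apply Rabs_le_between in H. apply cos_ge_0; lra. }
replace (z * Cconj w)%C with (RtoC (Cmod w ^ 2) * (z / w))%C
  by (rewrite Cmod2_conj; field; exact Hw).
rewrite Re_RtoC_mult.
apply Rmult_le_pos; [apply pow2_ge_0 | exact Hre].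
Qed.

(** Expanding the square, all cross terms are nonnegative. *)
Lemma acute_sum_Cmod2 (c : nat -> C) (p : nat) :
  (forall k l, (1 <= k <= p)%nat -> (1 <= l <= p)%nat -> 0 <= Re (c k * Cconj (c l))) ->
  sum_n_m (fun k => Cmod (c k) ^ 2) 1 p <= Cmod (sum_n_m c 1 p) ^ 2.
Proof.
intros H. induction p as [|p IH].
- rewrite Rsum_0. apply pow2_ge_0.
- rewrite Rsum_S, Csum_S, Cmod2_plus.
  specialize (IH ltac:(intros; apply H; lia)).
  assert (Hc : forall q, (q <= p)%nat -> 0 <= Re (sum_n_m c 1 q * Cconj (c (S p)))).
  { induction q as [|q IHq]; intros Hq.
    - rewrite Csum_0. replace (RtoC 0 * Cconj (c (S p)))%C with (RtoC 0) by ring.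
      simpl. lra.
    - rewrite Csum_S, Cmult_plus_distr_r.
      assert (Er : forall x y : C, Re (x + y) = Re x + Re y) by reflexivity.
      rewrite Er. specialize (IHq ltac:(lia)).
      pose proof (H (S q) (S p) ltac:(lia) ltac:(lia)). lra. }
  specialize (Hc p (le_n _)). lra.
Qed.

(** * The coefficient inequality *)

(** The expansion shared by all the statements below; analyticity of h and g is
    what the convergence of their series means. *)
Definition polyharmonic_expansion (p : nat) (F : C -> C) (a0 : C)
    (a b : nat -> nat -> C) (h g : nat -> C -> C) : Prop :=
  (forall (k : nat) (z : C), (1 <= k <= p)%nat -> disk 1 z ->
     is_series (fun m : nat => (a (S m) k * z ^ S m)%C) (h k z)) /\
  (forall (k : nat) (z : C), (1 <= k <= p)%nat -> disk 1 z ->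
     is_series (fun m : nat => (b (S m) k * z ^ S m)%C) (g k z)) /\
  (forall z : C, disk 1 z ->
     F z = (a0 + sum_n_m (fun k : nat =>
              RtoC (Cmod z ^ (2 * (k - 1))) * (h k z + Cconj (g k z))) 1 p)%C).

(** The condition on arguments in a form that needs no exception for zero
    coefficients. *)
Definition acute_coefficients (p : nat) (a : nat -> nat -> C) : Prop :=
  forall n k l, (1 <= n)%nat -> (1 <= k <= p)%nat -> (1 <= l <= p)%nat ->
    0 <= Re (a n k * Cconj (a n l)).

Lemma power_series_at_0 (al : nat -> C) (l : C) :
  is_series (fun m => al m * RtoC 0 ^ S m)%C l -> l = RtoC 0.
Proof.
intros H. apply Cmod_eq_0. apply Rle_antisym; [|apply Cmod_ge_0].
apply is_series_Cmod_le with (b := fun _ => 0) (1 := H).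
- intros m. rewrite Cpow_S.
  replace (al m * (0 * 0 ^ m))%C with (RtoC 0) by ring. rewrite Cmod_0. lra.
- intros N. rewrite sum_n_const. lra.
Qed.

Lemma expansion_constant (p : nat) (F : C -> C) (a0 : C) (a b : nat -> nat -> C)
    (h g : nat -> C -> C) :
  polyharmonic_expansion p F a0 a b h g -> F (RtoC 0) = a0.
Proof.
intros (Hh & Hg & HF).
assert (D0 : disk 1 (RtoC 0)) by (unfold disk; rewrite Cmod_0; lra).
rewrite HF by exact D0.
rewrite (Csum_ext _ (fun _ => RtoC 0 * RtoC 0)%C).
- rewrite Csum_mult_l. ring.
- intros k Hk.
  rewrite (power_series_at_0 (fun m => a (S m) k) _ (Hh k (RtoC 0) Hk D0)).
  rewrite (power_series_at_0 (fun m => b (S m) k) _ (Hg k (RtoC 0) Hk D0)).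
  apply injective_projections; simpl; ring.
Qed.

Lemma Cconj_RtoC (x : R) : Cconj (RtoC x) = RtoC x.
Proof. apply injective_projections; simpl; ring. Qed.

(** Collects the terms of the same degree, so that the truncated expansion on a
    circle becomes a trigonometric polynomial. *)
Lemma exchange_harmonic_sums (p N : nat) (t : nat -> R) (a b : nat -> nat -> C)
    (u : nat -> C) :
  (sum_n_m (fun k => RtoC (t k) * (sum_n_m (fun n => a n k * u n) 1 N
      + Cconj (sum_n_m (fun n => b n k * u n) 1 N))) 1 p)%C
  = (sum_n_m (fun n =>
      sum_n_m (fun k => RtoC (t k) * a n k) 1 p * u n
      + Cconj (sum_n_m (fun k => RtoC (t k) * b n k) 1 p * u n)) 1 N)%C :> C.
Proof.
induction p as [|p IH].
- rewrite Csum_0. rewrite (Csum_ext _ (fun _ => RtoC 0 * RtoC 0)%C).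
  + rewrite Csum_mult_l. ring.
  + intros n _. rewrite !Csum_0. apply injective_projections; simpl; ring.
- rewrite Csum_S, IH.
  rewrite (Csum_ext (fun n => (sum_n_m (fun k => RtoC (t k) * a n k) 1 (S p) * u n
      + Cconj (sum_n_m (fun k => RtoC (t k) * b n k) 1 (S p) * u n))%C)
    (fun n => ((sum_n_m (fun k => RtoC (t k) * a n k) 1 p * u n
        + Cconj (sum_n_m (fun k => RtoC (t k) * b n k) 1 p * u n))
      + RtoC (t (S p)) * (a n (S p) * u n + Cconj (b n (S p) * u n)))%C)).
  + rewrite !Csum_plus, (Csum_mult_l (RtoC (t (S p)))), !Csum_plus. do 3 f_equal.
    clear IH. induction N as [|N IH]; [rewrite !Csum_0; apply Cconj_RtoC|].
    rewrite !Csum_S, Cplus_conj, IH. reflexivity.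
  + intros n _. rewrite !Csum_S, !Cmult_conj, !Cplus_conj, !Cmult_conj, Cconj_RtoC.
    ring.
Qed.

Lemma eventually_forall_le (Q : nat -> nat -> Prop) (p : nat) :
  (forall k, (1 <= k <= p)%nat -> exists N0, forall N, (N0 <= N)%nat -> Q k N) ->
  exists N0, forall N, (N0 <= N)%nat -> forall k, (1 <= k <= p)%nat -> Q k N.
Proof.
induction p as [|p IH]; intros H; [exists 0%nat; intros; lia|].
destruct IH as [N1 H1]; [intros k Hk; apply H; lia|].
destruct (H (S p) ltac:(lia)) as [N2 H2].
exists (max N1 N2). intros N HN k Hk.
destruct (Nat.eq_dec k (S p)) as [->|Hk']; [apply H2; lia | apply H1; lia].
Qed.

(** F is uniformly close on the circle to its truncations, which are trigonometric
    polynomials bounded by M + eps. *)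
Lemma parseval_on_circle (p : nat) (F : C -> C) (a b : nat -> nat -> C)
    (h g : nat -> C -> C) (M r : R) (N : nat) :
  polyharmonic_expansion p F (RtoC 0) a b h g ->
  (forall z, disk 1 z -> Cmod (F z) <= M) -> 0 < r < 1 ->
  let A := fun c n => Cmod (RtoC (r ^ n)
     * sum_n_m (fun k => RtoC (r ^ (2 * (k - 1))) * c n k)%C 1 p) in
  sum_n_m (fun n => A a n ^ 2 + A b n ^ 2) 1 N <= M ^ 2.
Proof.
intros (Hh & Hg & HF) HM Hr A.
assert (HM0 : 0 <= M).
{ eapply Rle_trans; [apply (Cmod_ge_0 (F (RtoC 0)))|]. apply HM.
  unfold disk. rewrite Cmod_0. lra. }
assert (Hpos : forall n, 0 <= A a n ^ 2 + A b n ^ 2).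
{ intros n. pose proof (pow2_ge_0 (A a n)). pose proof (pow2_ge_0 (A b n)). lra. }
assert (Heps : forall eps, 0 < eps ->
  sum_n_m (fun n => A a n ^ 2 + A b n ^ 2) 1 N <= (M + eps) ^ 2).
{ intros eps He. set (e := eps / (2 * INR p + 1)).
  pose proof (pos_INR p) as Hp0.
  assert (He' : 0 < e) by (unfold e; apply Rdiv_lt_0_compat; lra).
  destruct (eventually_forall_le (fun k N => forall z, Cmod z <= r ->
      Cmod (h k z - sum_n (fun m => a (S m) k * z ^ S m)%C N) <= e) p) as [N1 HN1].
  { intros k Hk. apply (power_series_uniform_truncation (fun m => a (S m) k)); auto. }
  destruct (eventually_forall_le (fun k N => forall z, Cmod z <= r ->
      Cmod (g k z - sum_n (fun m => b (S m) k * z ^ S m)%C N) <= e) p) as [N2 HN2].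
  { intros k Hk. apply (power_series_uniform_truncation (fun m => b (S m) k)); auto. }
  set (K := (N1 + N2 + N)%nat).
  apply Rle_trans with (sum_n_m (fun n => A a n ^ 2 + A b n ^ 2) 1 (S K)).
  { rewrite (sum_n_m_Chasles _ 1 N (S K)) by (unfold K; lia). change plus with Rplus.
    pose proof (Rsum_nonneg (fun n => A a n ^ 2 + A b n ^ 2) (S N) (S K)
      (fun n _ => Hpos n)). lra. }
  set (cA := fun (c : nat -> nat -> C) n => (RtoC (r ^ n)
     * sum_n_m (fun k => RtoC (r ^ (2 * (k - 1))) * c n k)%C 1 p)%C).
  rewrite (sum_n_m_ext _
    (fun n => Cmod (cA a n) ^ 2 + Cmod (Cconj (cA b n)) ^ 2))
    by (intros n; rewrite Cmod_conj; reflexivity).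
  apply (bessel_circle (cA a) (fun n => Cconj (cA b n)) (S K)). intros t.
  set (z := (RtoC r * cis t)%C).
  assert (Hz : Cmod z = r).
  { unfold z. rewrite Cmod_mult, Cmod_cis, Cmod_R, Rabs_pos_eq by lra. ring. }
  assert (Dz : disk 1 z) by (unfold disk; lra).
  set (s := fun (c : nat -> nat -> C) k => (sum_n_m (fun n => c n k * z ^ n)%C 1 (S K) : C)).
  assert (Es : forall (c : nat -> nat -> C) k,
    sum_n (fun m => c (S m) k * z ^ S m)%C K = s c k).
  { intros c k. exact (sum_n_m_S (fun n => c n k * z ^ n)%C 0 K). }
  assert (ET : trig_poly (cA a) (fun n => Cconj (cA b n)) (S K) (fun d => cis (IZR d * t))
    = sum_n_m (fun k => RtoC (r ^ (2 * (k - 1))) * (s a k + Cconj (s b k)))%C 1 p).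
  { unfold s. rewrite exchange_harmonic_sums. unfold trig_poly.
    apply Csum_ext. intros n _.
    replace (z ^ n)%C with (RtoC (r ^ n) * cis (IZR (Z.of_nat n) * t))%C.
    2:{ unfold z. rewrite Cpow_mult_l, cis_pow, RtoC_pow, INR_IZR_INZ. reflexivity. }
    unfold cA. rewrite !Cmult_conj, Cconj_cis, Cconj_RtoC, opp_IZR.
    replace (- IZR (Z.of_nat n) * t) with (- (IZR (Z.of_nat n) * t)) by ring.
    ring. }
  rewrite ET.
  set (T := (sum_n_m (fun k => RtoC (r ^ (2 * (k - 1))) * (s a k + Cconj (s b k)))%C 1 p : C)).
  assert (Hdiff : Cmod (F z - T) <= INR p * (2 * e)).
  { rewrite HF by exact Dz. rewrite Hz.
    replace (RtoC 0 + _ - T)%C with (sum_n_m (fun k =>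
      (RtoC (r ^ (2 * (k - 1))) * ((h k z - s a k) + Cconj (g k z - s b k)))%C) 1 p : C).
    2:{ unfold T. rewrite <- (Csum_ext (fun k =>
          (RtoC (r ^ (2 * (k - 1))) * (h k z + Cconj (g k z))
            + (- RtoC 1) * (RtoC (r ^ (2 * (k - 1))) * (s a k + Cconj (s b k))))%C)).
        - rewrite Csum_plus, Csum_mult_l. ring.
        - intros k _. rewrite Cminus_conj. ring. }
    eapply Rle_trans; [apply Csum_Cmod_le with (b := fun _ => 2 * e)|].
    - intros k Hk. rewrite Cmod_mult, Cmod_R, Rabs_pos_eq by (apply pow_le; lra).
      assert (H1 : r ^ (2 * (k - 1)) <= 1).
      { rewrite <- (pow1 (2 * (k - 1))). apply pow_incr. lra. }
      pose proof (HN1 K ltac:(unfold K; lia) k Hk z ltac:(lra)) as Ha.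
      pose proof (HN2 K ltac:(unfold K; lia) k Hk z ltac:(lra)) as Hb.
      rewrite Es in Ha, Hb.
      pose proof (Cmod_triangle (h k z - s a k) (Cconj (g k z - s b k))) as H2.
      rewrite Cmod_conj in H2.
      apply Rle_trans with (1 * Cmod (h k z - s a k + Cconj (g k z - s b k))); [|lra].
      apply Rmult_le_compat_r; [apply Cmod_ge_0 | exact H1].
    - rewrite sum_n_m_const. replace (S p - 1)%nat with p by lia. lra. }
  pose proof (HM z Dz) as H1.
  pose proof (Cmod_triangle_rev T (F z)) as H2. rewrite Cmod_minus_sym in H2.
  assert (H3 : INR p * (2 * e) <= eps).
  { apply Rle_trans with ((2 * INR p + 1) * e); [lra|].
    unfold e. right. field. lra. }
  lra. }
apply Rnot_lt_le. intros Hlt.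
set (X := sum_n_m (fun n => A a n ^ 2 + A b n ^ 2) 1 N : R) in *.
(* this eps is at most 1 and satisfies (M + eps)^2 < X *)
specialize (Heps (Rmin 1 ((X - M ^ 2) / (2 * (2 * M + 1))))).
set (e := Rmin 1 ((X - M ^ 2) / (2 * (2 * M + 1)))) in *.
assert (He : 0 < e).
{ unfold e. apply Rmin_pos; [lra|]. apply Rdiv_lt_0_compat; lra. }
specialize (Heps He).
assert (He1 : e <= 1) by apply Rmin_l.
assert (He2 : e * (2 * (2 * M + 1)) <= X - M ^ 2).
{ apply Rle_trans with ((X - M ^ 2) / (2 * (2 * M + 1)) * (2 * (2 * M + 1))).
  - apply Rmult_le_compat_r; [lra | apply Rmin_r].
  - right. field. lra. }
nra.
Qed.

(** The passage r -> 1, made quantitative by the Bernoulli inequality. *)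
Lemma le_of_pow_mult_le (S B : R) (Q : nat) : 0 <= S ->
  (forall r, 0 < r < 1 -> r ^ Q * S <= B) -> S <= B.
Proof.
intros HS H. apply Rnot_lt_le. intros Hlt.
assert (HSp : 0 < S) by (destruct (Req_dec S 0) as [->|]; [|lra];
  specialize (H (1 / 2) ltac:(lra)); lra).
(* Bernoulli: (1 - x)^Q >= 1 - Q x *)
set (x := Rmin (1 / 2) ((S - B) / (2 * S * (INR Q + 1)))).
pose proof (pos_INR Q) as HQ.
assert (Hx : 0 < x).
{ unfold x. apply Rmin_pos; [lra|]. apply Rdiv_lt_0_compat; [lra|].
  apply Rmult_lt_0_compat; lra. }
assert (Hx1 : x <= 1 / 2) by apply Rmin_l.
assert (Hx2 : x * (2 * S * (INR Q + 1)) <= S - B).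
{ apply Rle_trans with ((S - B) / (2 * S * (INR Q + 1)) * (2 * S * (INR Q + 1))).
  - apply Rmult_le_compat_r; [|apply Rmin_r]. apply Rmult_le_pos; lra.
  - right. field. lra. }
specialize (H (1 - x) ltac:(lra)).
assert (HB : 1 - INR Q * x <= (1 - x) ^ Q).
{ clearbody x. clear - Hx Hx1. induction Q as [|Q IH]; [simpl; lra|].
  rewrite S_INR. simpl. pose proof (pos_INR Q) as HQ.
  pose proof (Rmult_le_compat_l (1 - x) _ _ ltac:(lra) IH) as H1.
  assert (0 <= INR Q * (x * x)) by (apply Rmult_le_pos; nra). lra. }
assert (HB2 : (1 - INR Q * x) * S <= (1 - x) ^ Q * S) by (apply Rmult_le_compat_r; lra).
nra.
Qed.

(** On the circle of radius r, each inner sum over k dominates the sum of its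
    squares by acuteness; all powers of r that occur are at least r^(2N+4p). *)
Lemma coefficient_inequality (p : nat) (F : C -> C) (a b : nat -> nat -> C)
    (h g : nat -> C -> C) (M : R) (N : nat) :
  polyharmonic_expansion p F (RtoC 0) a b h g ->
  acute_coefficients p a -> acute_coefficients p b ->
  (forall z, disk 1 z -> Cmod (F z) <= M) ->
  sum_n_m (fun n => sum_n_m (fun k => Cmod (a n k) ^ 2 + Cmod (b n k) ^ 2) 1 p) 1 N
  <= M ^ 2.
Proof.
intros HE Ha Hb HM.
apply le_of_pow_mult_le with (Q := (2 * N + 4 * p)%nat).
{ apply Rsum_nonneg. intros n _. apply Rsum_nonneg. intros k _.
  pose proof (pow2_ge_0 (Cmod (a n k))). pose proof (pow2_ge_0 (Cmod (b n k))). lra. }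
intros r Hr.
eapply Rle_trans; [|exact (parseval_on_circle p F a b h g M r N HE HM Hr)].
rewrite <- Rsum_mult_l. apply Rsum_le_loc. intros n Hn.
assert (Hone : forall c, acute_coefficients p c ->
  r ^ (2 * N + 4 * p) * sum_n_m (fun k => Cmod (c n k) ^ 2) 1 p
  <= Cmod (RtoC (r ^ n) * sum_n_m (fun k => RtoC (r ^ (2 * (k - 1))) * c n k)%C 1 p) ^ 2).
{ intros c Hc. rewrite Cmod_mult, Rpow_mult_distr, Cmod_R.
  rewrite Rabs_pos_eq by (apply pow_le; lra).
  apply Rle_trans with ((r ^ n) ^ 2
    * sum_n_m (fun k => Cmod (RtoC (r ^ (2 * (k - 1))) * c n k) ^ 2) 1 p).
  - rewrite <- !Rsum_mult_l. apply Rsum_le_loc. intros k Hk.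
    rewrite Cmod_mult, Rpow_mult_distr, Cmod_R.
    rewrite Rabs_pos_eq by (apply pow_le; lra).
    rewrite <- Rmult_assoc. apply Rmult_le_compat_r; [apply pow2_ge_0|].
    rewrite <- !pow_mult, <- pow_add.
    replace (2 * N + 4 * p)%nat with
      ((n * 2 + 2 * (k - 1) * 2) + (2 * N + 4 * p - (n * 2 + 2 * (k - 1) * 2)))%nat by lia.
    rewrite pow_add, <- (Rmult_1_r (r ^ (n * 2 + 2 * (k - 1) * 2))) at 1.
    rewrite Rmult_assoc, Rmult_1_l.
    apply Rle_trans with (r ^ (n * 2 + 2 * (k - 1) * 2) * 1); [|lra].
    apply Rmult_le_compat_l; [apply pow_le; lra|].
    rewrite <- (pow1 (2 * N + 4 * p - (n * 2 + 2 * (k - 1) * 2))).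
    apply pow_incr. lra.
  - apply Rmult_le_compat_l; [apply pow2_ge_0|]. apply acute_sum_Cmod2.
    intros k l Hk Hl. specialize (Hc n k l ltac:(lia) Hk Hl).
    rewrite Cmult_conj, Cconj_RtoC.
    replace (RtoC (r ^ (2 * (k - 1))) * c n k * (RtoC (r ^ (2 * (l - 1))) * Cconj (c n l)))%C
      with (RtoC (r ^ (2 * (k - 1)) * r ^ (2 * (l - 1))) * (c n k * Cconj (c n l)))%C
      by (rewrite RtoC_mult; ring).
    rewrite Re_RtoC_mult. apply Rmult_le_pos; [|exact Hc].
    apply Rmult_le_pos; apply pow_le; lra. }
pose proof (Hone a Ha). pose proof (Hone b Hb).
rewrite Rsum_plus. lra.
Qed.

(** * Bounds in terms of the lower dilatation *)


(** Lower and upper dilatation are inverse to each other when the Jacobian is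
    plus or minus 1. *)
Lemma dilatation_product (A B : R) : 0 <= A -> 0 <= B ->
  Rabs (A ^ 2 - B ^ 2) = 1 -> Rabs (A - B) * (A + B) = 1.
Proof.
intros HA HB H. rewrite <- H, <- (Rabs_pos_eq (A + B)) at 1 by lra.
rewrite <- Rabs_mult. f_equal. ring.
Qed.

Lemma dilatation_squares (A B : R) :
  2 * (A ^ 2 + B ^ 2) = Rabs (A - B) ^ 2 + (A + B) ^ 2.
Proof. rewrite pow2_abs. ring. Qed.

(** With u and v the lower and upper dilatation, u v = 1 and u^2 + v^2 <= 2 M^2
    bound u + v and v - u, hence v, from above by means of square roots of
    M^2 + 1 and M^2 - 1. *)
Lemma lambda0_le (A B M : R) : 0 <= A -> 0 <= B -> 1 <= M ->
  Rabs (A ^ 2 - B ^ 2) = 1 -> A ^ 2 + B ^ 2 <= M ^ 2 ->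
  lambda0 M <= Rabs (A - B).
Proof.
intros HA HB HM HJ HS.
pose proof (dilatation_product A B HA HB HJ) as Huv.
pose proof (dilatation_squares A B) as Hsq.
set (u := Rabs (A - B)) in *. set (v := A + B) in *.
assert (Hu : 0 <= u) by apply Rabs_pos. assert (Hv : 0 <= v) by (unfold v; lra).
set (s := sqrt (M ^ 2 - 1)). set (t := sqrt (M ^ 2 + 1)).
assert (Hs : 0 <= s) by apply sqrt_pos.
assert (Ht : 0 < t) by (apply sqrt_lt_R0; nra).
assert (Es : s * s = M ^ 2 - 1) by (apply sqrt_sqrt; nra).
assert (Et : t * t = M ^ 2 + 1) by (apply sqrt_sqrt; nra).
set (c := sqrt 2). assert (Hc : 0 < c) by (apply sqrt_lt_R0; lra).
assert (Ec : c * c = 2) by (apply sqrt_sqrt; lra).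
unfold lambda0. fold s t c.
assert (H1 : u + v <= c * t).
{ apply Rsqr_incr_0_var; [unfold Rsqr; nra | apply Rmult_le_pos; lra]. }
assert (H2 : v - u <= c * s).
{ apply Rsqr_incr_0_var; [unfold Rsqr; nra | apply Rmult_le_pos; lra]. }
apply Rmult_le_reg_r with (s + t); [lra|].
unfold Rdiv. rewrite Rmult_assoc, Rinv_l, Rmult_1_r by lra.
assert (H3 : 2 * v <= c * (s + t)) by lra.
assert (H4 : u * (2 * v) <= u * (c * (s + t))) by (apply Rmult_le_compat_l; lra).
apply Rmult_le_reg_l with c; [exact Hc|]. nra.
Qed.

(** Since (s + t)^2 <= 2 (s^2 + t^2) <= 2 M^2 - u^2 - v^2, the claim is the
    arithmetic-geometric mean inequality 2 M^2 <= M^4 u^2 + v^2. *)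
Lemma coefficient_le_lambda (A B s t M : R) : 0 <= A -> 0 <= B -> 1 <= M ->
  Rabs (A ^ 2 - B ^ 2) = 1 -> A ^ 2 + B ^ 2 + (s ^ 2 + t ^ 2) <= M ^ 2 ->
  s + t <= sqrt (M ^ 4 - 1) * Rabs (A - B).
Proof.
intros HA HB HM HJ HS.
pose proof (dilatation_product A B HA HB HJ) as Huv.
pose proof (dilatation_squares A B) as Hsq.
set (u := Rabs (A - B)) in *. set (v := A + B) in *.
assert (Hu : 0 <= u) by apply Rabs_pos.
assert (HM4 : 0 <= M ^ 4 - 1).
{ replace (M ^ 4 - 1) with ((M ^ 2 - 1) * (M ^ 2 + 1)) by ring.
  apply Rmult_le_pos; nra. }
set (K := sqrt (M ^ 4 - 1)). assert (HK : 0 <= K) by apply sqrt_pos.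
assert (EK : K * K = M ^ 4 - 1) by (apply sqrt_sqrt; exact HM4).
apply Rsqr_incr_0_var; [|apply Rmult_le_pos; lra]. unfold Rsqr.
replace (K * u * (K * u)) with ((K * K) * u ^ 2) by ring. rewrite EK.
(* arithmetic-geometric mean inequality for M^2 u and v, using u v = 1 *)
assert (H1 : 2 * M ^ 2 <= M ^ 4 * u ^ 2 + v ^ 2).
{ pose proof (pow2_ge_0 (M ^ 2 * u - v)) as H.
  replace ((M ^ 2 * u - v) ^ 2) with (M ^ 4 * u ^ 2 + v ^ 2 - 2 * M ^ 2 * (u * v)) in H
    by ring.
  rewrite Huv in H. lra. }
assert (H2 : (s + t) * (s + t) <= 2 * (s ^ 2 + t ^ 2)).
{ pose proof (pow2_ge_0 (s - t)). nra. }
lra.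
Qed.

(** * The majorants and the radius *)

(** The function phi with [r6_fun M p r = 1 - sqrt (M ^ 4 - 1) * phi r]. *)
Definition lipschitz_majorant (p : nat) (r : R) : R :=
  (2 * r - r ^ 2) / (1 - r) ^ 2
  + sum_n_m (fun k : nat => 2 * r ^ (2 * k - 1) / (1 - r) ^ 3) 1 p
  + sum_n_m (fun k : nat =>
      INR (2 * k - 1) * r ^ (2 * (k - 1)) / (1 - r) ^ 2) 2 p.

(** The function psi occurring in [rho6_val]. *)
Definition size_majorant (p : nat) (r : R) : R :=
  (2 * r - r ^ 2) / (1 - r) ^ 2
  + sum_n_m (fun k : nat => r ^ (2 * (k - 1)) / (1 - r) ^ 2) 2 p.

(** The form in which the majorant arises: the summand k is the sum over n of
    n (2 (k - 1) + n) r^(2(k-1)+n-1), and for k = 1 the term n = 1 is missing. *)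
Lemma lipschitz_majorant_eq (p : nat) (r : R) : (1 <= p)%nat -> r <> 1 ->
  lipschitz_majorant p r = ((1 + r) / (1 - r) ^ 3 - 1)
    + sum_n_m (fun k => r ^ (2 * (k - 1))
        * (2 * INR (k - 1) * (1 / (1 - r) ^ 2) + (1 + r) / (1 - r) ^ 3)) 2 p.
Proof.
intros Hp Hr. assert (Hr1 : 1 - r <> 0) by lra.
unfold lipschitz_majorant. rewrite (sum_Sn_m _ 1 p) by exact Hp.
change plus with Rplus.
assert (E : sum_n_m (fun k => r ^ (2 * (k - 1))
      * (2 * INR (k - 1) * (1 / (1 - r) ^ 2) + (1 + r) / (1 - r) ^ 3)) 2 p
  = sum_n_m (fun k => 2 * r ^ (2 * k - 1) / (1 - r) ^ 3) 2 p
    + sum_n_m (fun k => INR (2 * k - 1) * r ^ (2 * (k - 1)) / (1 - r) ^ 2) 2 p).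
{ rewrite <- Rsum_plus. apply sum_n_m_ext_loc. intros k Hk.
  replace (2 * k - 1)%nat with (S (2 * (k - 1))) by lia.
  rewrite S_INR, mult_INR, <- (tech_pow_Rmult r). simpl (INR 2).
  set (x := r ^ (2 * (k - 1))). change (@eq R
    (x * (2 * INR (k - 1) * (1 / (1 - r) ^ 2) + (1 + r) / (1 - r) ^ 3))
    (2 * (r * x) / (1 - r) ^ 3 + ((1 + 1) * INR (k - 1) + 1) * x / (1 - r) ^ 2)).
  field. exact Hr1. }
rewrite E. simpl (2 * 1 - 1)%nat. field. exact Hr1.
Qed.

Lemma pow_div_le (r s : R) (n m : nat) : 0 <= r <= s -> s < 1 ->
  0 <= r ^ n / (1 - r) ^ m <= s ^ n / (1 - s) ^ m.
Proof.
intros Hr Hs. split.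
- apply Rdiv_le_0_compat; [apply pow_le | apply pow_lt]; lra.
- apply Rmult_le_compat; [apply pow_le; lra | | apply pow_incr; lra |].
  + left. apply Rinv_0_lt_compat, pow_lt. lra.
  + apply Rinv_le_contravar; [apply pow_lt; lra | apply pow_incr; lra].
Qed.

Lemma leading_majorant_eq (r : R) : r <> 1 ->
  (2 * r - r ^ 2) / (1 - r) ^ 2 = 1 / (1 - r) ^ 2 - 1.
Proof. intros H. field. lra. Qed.

Lemma size_majorant_mono (p : nat) (r s : R) : 0 <= r <= s -> s < 1 ->
  0 <= size_majorant p r <= size_majorant p s.
Proof.
intros Hr Hs. unfold size_majorant. rewrite !leading_majorant_eq by lra.
pose proof (pow_div_le r s 0 2 Hr Hs) as H1. pose proof (pow_div_le 0 r 0 2 ltac:(lra) ltac:(lra)) as H0.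
simpl (_ ^ 0) in H1, H0.
replace (1 / (1 - 0) ^ 2) with 1 in H0 by field.
assert (H2 : sum_n_m (fun k => r ^ (2 * (k - 1)) / (1 - r) ^ 2) 2 p
  <= sum_n_m (fun k => s ^ (2 * (k - 1)) / (1 - s) ^ 2) 2 p).
{ apply sum_n_m_le. intros k. now apply pow_div_le. }
assert (H3 : 0 <= sum_n_m (fun k => r ^ (2 * (k - 1)) / (1 - r) ^ 2) 2 p).
{ apply Rsum_nonneg. intros k _. now apply (pow_div_le r s). }
lra.
Qed.

Lemma lipschitz_majorant_increasing (p : nat) (r s : R) : 0 <= r < s -> s < 1 ->
  lipschitz_majorant p r < lipschitz_majorant p s.
Proof.
intros Hr Hs. unfold lipschitz_majorant. rewrite !leading_majorant_eq by lra.
assert (H1 : 1 / (1 - r) ^ 2 < 1 / (1 - s) ^ 2).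
{ unfold Rdiv. rewrite !Rmult_1_l. apply Rinv_lt_contravar.
  - apply Rmult_lt_0_compat; apply pow_lt; lra.
  - simpl. nra. }
assert (H2 : sum_n_m (fun k => 2 * r ^ (2 * k - 1) / (1 - r) ^ 3) 1 p
  <= sum_n_m (fun k => 2 * s ^ (2 * k - 1) / (1 - s) ^ 3) 1 p).
{ apply sum_n_m_le. intros k.
  pose proof (pow_div_le r s (2 * k - 1) 3 ltac:(lra) Hs). unfold Rdiv in *. lra. }
assert (H3 : sum_n_m (fun k => INR (2 * k - 1) * r ^ (2 * (k - 1)) / (1 - r) ^ 2) 2 p
  <= sum_n_m (fun k => INR (2 * k - 1) * s ^ (2 * (k - 1)) / (1 - s) ^ 2) 2 p).
{ apply sum_n_m_le. intros k.
  pose proof (pow_div_le r s (2 * (k - 1)) 2 ltac:(lra) Hs) as H.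
  unfold Rdiv. rewrite !Rmult_assoc.
  apply Rmult_le_compat_l; [apply pos_INR | apply H]. }
lra.
Qed.

Lemma lipschitz_majorant_ge (p : nat) (r : R) : 0 <= r < 1 ->
  1 / (1 - r) ^ 2 - 1 <= lipschitz_majorant p r.
Proof.
intros Hr. unfold lipschitz_majorant. rewrite leading_majorant_eq by lra.
assert (H1 : 0 <= sum_n_m (fun k => 2 * r ^ (2 * k - 1) / (1 - r) ^ 3) 1 p).
{ apply Rsum_nonneg. intros k _.
  pose proof (pow_div_le r r (2 * k - 1) 3 ltac:(lra) ltac:(lra)). unfold Rdiv in *. lra. }
assert (H2 : 0 <= sum_n_m (fun k => INR (2 * k - 1) * r ^ (2 * (k - 1)) / (1 - r) ^ 2) 2 p).
{ apply Rsum_nonneg. intros k _.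
  pose proof (pow_div_le r r (2 * (k - 1)) 2 ltac:(lra) ltac:(lra)).
  unfold Rdiv. rewrite Rmult_assoc. apply Rmult_le_pos; [apply pos_INR | apply H]. }
lra.
Qed.

Lemma size_lt_lipschitz_majorant (p : nat) (r : R) : (1 <= p)%nat -> 0 < r < 1 ->
  size_majorant p r < lipschitz_majorant p r.
Proof.
intros Hp Hr. unfold size_majorant, lipschitz_majorant.
assert (H1 : 0 < sum_n_m (fun k => 2 * r ^ (2 * k - 1) / (1 - r) ^ 3) 1 p).
{ eapply Rlt_le_trans; [|apply (Rsum_ge_term _ 1 p 1); [|lia]].
  - apply Rdiv_lt_0_compat; [|apply pow_lt; lra].
    apply Rmult_lt_0_compat; [lra | apply pow_lt; lra].
  - intros k _. apply Rdiv_le_0_compat; [|apply pow_lt; lra].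
    apply Rmult_le_pos; [lra | apply pow_le; lra]. }
assert (H2 : sum_n_m (fun k => r ^ (2 * (k - 1)) / (1 - r) ^ 2) 2 p
  <= sum_n_m (fun k => INR (2 * k - 1) * r ^ (2 * (k - 1)) / (1 - r) ^ 2) 2 p).
{ apply Rsum_le_loc. intros k Hk.
  unfold Rdiv. rewrite Rmult_assoc.
  rewrite <- (Rmult_1_l (r ^ (2 * (k - 1)) * / (1 - r) ^ 2)) at 1.
  apply Rmult_le_compat_r; [apply (pow_div_le r r); lra|].
  apply (le_INR 1). lia. }
lra.
Qed.

Lemma continuous_Rsum (f : nat -> R -> R) (n m : nat) (x : R) :
  (forall k, continuous (f k) x) ->
  continuous (fun y => sum_n_m (fun k => f k y) n m) x.
Proof.
intros H.
destruct (Nat.le_gt_cases n m) as [Hnm|Hnm].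
2:{ apply continuous_ext with (fun _ => 0); [|apply continuous_const].
    intros y. now rewrite sum_n_m_zero. }
replace m with (n + (m - n))%nat by lia.
induction (m - n)%nat as [|d IH].
- rewrite Nat.add_0_r. apply continuous_ext with (f n); [|apply H].
  intros y. now rewrite sum_n_n.
- rewrite Nat.add_succ_r.
  apply continuous_ext with (fun y => plus (sum_n_m (fun k => f k y) n (n + d)) (f (S (n + d)) y)).
  + intros y. now rewrite sum_n_Sm by lia.
  + apply (continuous_plus (V := R_NormedModule)); [exact IH | apply H].
Qed.

Lemma lipschitz_majorant_continuous (p : nat) (r : R) : r < 1 ->
  continuous (lipschitz_majorant p) r.
Proof.
intros Hr. unfold lipschitz_majorant.
assert (Hne : forall n, (1 - r) ^ n <> 0) by (intros; apply pow_nonzero; lra).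
apply (continuous_plus (V := R_NormedModule)
  (fun r => (2 * r - r ^ 2) / (1 - r) ^ 2
    + sum_n_m (fun k : nat => 2 * r ^ (2 * k - 1) / (1 - r) ^ 3) 1 p)).
- apply (continuous_plus (V := R_NormedModule) (fun r => (2 * r - r ^ 2) / (1 - r) ^ 2)).
  + apply (ex_derive_continuous (V := R_NormedModule)). auto_derive.
    exact (Hne 2%nat).
  + apply continuous_Rsum. intros k.
    apply (ex_derive_continuous (V := R_NormedModule)). auto_derive.
    exact (Hne 3%nat).
- apply continuous_Rsum. intros k.
  apply (ex_derive_continuous (V := R_NormedModule)). auto_derive.
  exact (Hne 2%nat).
Qed.

Lemma lipschitz_majorant_0 (p : nat) : lipschitz_majorant p 0 = 0.
Proof.
unfold lipschitz_majorant.
rewrite (sum_n_m_ext_loc _ (fun _ => 0) 1 p).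
2:{ intros k Hk. rewrite pow_i by lia. change (2 * 0 / (1 - 0) ^ 3 = 0). field. }
rewrite (sum_n_m_ext_loc _ (fun _ => 0) 2 p).
2:{ intros k Hk. rewrite pow_i by lia.
    change (INR (2 * k - 1) * 0 / (1 - 0) ^ 2 = 0). field. }
rewrite !sum_n_m_const. field.
Qed.

(** A root in (0,1) exists because the majorant is continuous, vanishes at 0 and
    is at least 1 / (1 - r)^2 - 1.  It is the least one by strict monotonicity on
    [0,1). *)
Lemma r6_exists (M : R) (p : nat) : 1 < M ->
  exists r, least_positive_root (r6_fun M p) r /\ r < 1.
Proof.
intros HM.
set (K := sqrt (M ^ 4 - 1)).
assert (HK : 0 < K).
{ apply sqrt_lt_R0. replace (M ^ 4 - 1) with ((M ^ 2 - 1) * (M ^ 2 + 1)) by ring.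
  apply Rmult_lt_0_compat; nra. }
assert (Ef : forall r, r6_fun M p r = 1 - K * lipschitz_majorant p r) by reflexivity.
set (c := 2 + / K).
assert (HiK : 0 < / K) by now apply Rinv_0_lt_compat.
assert (Hc : 2 < c) by (unfold c; lra).
set (y := 1 - / c).
assert (Hic : 0 < / c < 1).
{ split; [apply Rinv_0_lt_compat; lra|]. rewrite <- Rinv_1.
  apply Rinv_lt_contravar; lra. }
destruct (IVT_interv (fun r => K * lipschitz_majorant p r - 1) 0 y) as [r [Hr E]].
- intros a Ha. apply continuity_pt_filterlim.
  apply (continuous_minus (V := R_NormedModule) (fun r => K * lipschitz_majorant p r));
    [|apply continuous_const].
  apply (continuous_mult (K := R_AbsRing) (fun _ => K)); [apply continuous_const|].
  apply lipschitz_majorant_continuous. unfold y in Ha. lra.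
- unfold y. lra.
- rewrite lipschitz_majorant_0. lra.
- pose proof (lipschitz_majorant_ge p y ltac:(unfold y; lra)) as H.
  replace (1 / (1 - y) ^ 2) with (c ^ 2) in H by (unfold y; field; lra).
  assert (H1 : / K < lipschitz_majorant p y) by (unfold c in *; nra).
  apply (Rmult_lt_compat_l K) in H1; [|exact HK]. rewrite Rinv_r in H1 by lra. lra.
- exists r. cbv beta in E.
  assert (Hr1 : r < 1) by (unfold y in Hr; lra).
  assert (Hr0 : 0 < r).
  { destruct (Req_dec r 0) as [->|]; [|lra]. rewrite lipschitz_majorant_0 in E. lra. }
  split; [|exact Hr1]. split.
  + split; [exact Hr0|]. split; [lra|]. rewrite Ef. lra.
  + intros s (Hs & Hs1 & Es). rewrite Ef in Es.
    apply Rnot_lt_le. intros Hsr.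
    pose proof (lipschitz_majorant_increasing p s r ltac:(lra) Hr1) as H.
    apply (Rmult_lt_compat_l K) in H; [lra | exact HK].
Qed.

(** * Action of L on the expansion *)

Definition coefficients (c : nat -> nat -> C) (k m : nat) : C := c (S m) k.

(** What L makes of h_k + conj g_k. *)
Definition L_summand (a b : nat -> nat -> C) (k : nat) (z : C) : C :=
  (z * power_series_derivative (coefficients a k) z
   - Cconj (z * power_series_derivative (coefficients b k) z))%C.

Lemma wirtinger_expansion (p : nat) (F : C -> C) (a b : nat -> nat -> C)
    (h g : nat -> C -> C) (B : R) (z : C) :
  polyharmonic_expansion p F (RtoC 0) a b h g ->
  (forall k m, (1 <= k <= p)%nat -> Cmod (a (S m) k) <= B) ->
  (forall k m, (1 <= k <= p)%nat -> Cmod (b (S m) k) <= B) ->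
  disk 1 z ->
  let w := fun k => (RtoC (INR (k - 1) * Cmod z ^ (2 * pred (k - 1)))
                     * (h k z + Cconj (g k z)))%C in
  wirtinger F z
    (sum_n_m (fun k => w k * Cconj z
       + RtoC (Cmod z ^ (2 * (k - 1))) * power_series_derivative (coefficients a k) z)%C 1 p)
    (sum_n_m (fun k => w k * z
       + RtoC (Cmod z ^ (2 * (k - 1)))
         * Cconj (power_series_derivative (coefficients b k) z))%C 1 p).
Proof.
intros (Hh & Hg & HF) Ha Hb Hz w.
apply wirtinger_ext_disk with (r := 1) (F := fun z => sum_n_m (fun k : nat =>
  RtoC (Cmod z ^ (2 * (k - 1))) * (h k z + Cconj (g k z)))%C 1 p); [exact Hz| |].
{ intros u Hu. rewrite HF by exact Hu. now rewrite Cplus_0_l. }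
apply (wirtinger_sum (fun k z =>
  RtoC (Cmod z ^ (2 * (k - 1))) * (h k z + Cconj (g k z)))%C).
intros k Hk.
assert (H1 : wirtinger (h k) z (power_series_derivative (coefficients a k) z) 0%C)
  by (apply wirtinger_power_series with B;
    [intros; now apply Ha | intros; now apply Hh | exact Hz]).
assert (H2 : wirtinger (g k) z (power_series_derivative (coefficients b k) z) 0%C)
  by (apply wirtinger_power_series with B;
    [intros; now apply Hb | intros; now apply Hg | exact Hz]).
pose proof (wirtinger_mult _ _ _ _ _ _ _ (wirtinger_mod_pow (k - 1) z)
  (wirtinger_plus _ _ _ _ _ _ _ H1 (wirtinger_Cconj _ _ _ _ H2))) as H.
eapply wirtinger_eq; [exact H | |]; unfold w; cbv beta; rewrite ?Cconj_RtoC; ring.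
Qed.

(** In z F_z - conj z F_zbar the derivatives of |z|^(2(k-1)) cancel. *)
Lemma L_op_expansion (p : nat) (F : C -> C) (a b : nat -> nat -> C)
    (h g : nat -> C -> C) (B : R) (z : C) :
  polyharmonic_expansion p F (RtoC 0) a b h g ->
  (forall k m, (1 <= k <= p)%nat -> Cmod (a (S m) k) <= B) ->
  (forall k m, (1 <= k <= p)%nat -> Cmod (b (S m) k) <= B) ->
  disk 1 z ->
  L_op F z = sum_n_m (fun k => RtoC (Cmod z ^ (2 * (k - 1))) * L_summand a b k z)%C 1 p.
Proof.
intros HE Ha Hb Hz.
destruct (wirtinger_d _ _ _ _ (wirtinger_expansion p F a b h g B z HE Ha Hb Hz)) as [E1 E2].
unfold L_op. rewrite E1, E2. unfold Cminus.
replace (- (Cconj z * sum_n_m _ 1 p))%C with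
  ((- Cconj z) * sum_n_m (fun k => RtoC (INR (k - 1) * Cmod z ^ (2 * pred (k - 1)))
                     * (h k z + Cconj (g k z)) * z
       + RtoC (Cmod z ^ (2 * (k - 1)))
         * Cconj (power_series_derivative (coefficients b k) z))%C 1 p)%C by ring.
rewrite <- !Csum_mult_l, <- Csum_plus. apply Csum_ext. intros k Hk.
unfold L_summand. rewrite Cmult_conj. ring.
Qed.

Lemma is_series_drop_first (u : nat -> C) (l : C) :
  is_series u l ->
  is_series (fun m => match m with O => RtoC 0 | S _ => u m end) (l - u 0%nat)%C.
Proof.
intros H. apply is_series_decr_1.
apply (is_series_incr_1 u).
match goal with |- is_series _ ?x => replace x with l; [exact H|] end.
change (l = ((l - u 0%nat) + - 0 + u 0%nat)%C). ring.
Qed.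

Lemma power_series_derivative_0 (al : nat -> C) (B : R) :
  (forall m, Cmod (al m) <= B) ->
  power_series_derivative al (RtoC 0) = al 0%nat.
Proof.
intros HB.
assert (D0 : disk 1 (RtoC 0)) by (unfold disk; rewrite Cmod_0; lra).
pose proof (is_series_drop_first _ _ (is_series_derivative al B (RtoC 0) HB D0)) as H.
cbv beta in H.
replace (al 0%nat) with (RtoC (INR 1) * al 0%nat * RtoC 0 ^ 0)%C
  by (apply injective_projections; simpl; ring).
apply Cminus_eq_0.
apply is_series_Cmod_le with (b := fun _ => 0) (1 := H).
- intros [|m]; [rewrite Cmod_0; lra|].
  rewrite Cpow_S. replace (_ * (0 * 0 ^ m))%C with (RtoC 0) by ring. rewrite Cmod_0. lra.
- intros N. rewrite sum_n_const. lra.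
Qed.

(** At 0 only the linear terms of h_1 and g_1 survive. *)
Lemma jacobian_expansion (p : nat) (F : C -> C) (a b : nat -> nat -> C)
    (h g : nat -> C -> C) (B : R) : (1 <= p)%nat ->
  polyharmonic_expansion p F (RtoC 0) a b h g ->
  (forall k m, (1 <= k <= p)%nat -> Cmod (a (S m) k) <= B) ->
  (forall k m, (1 <= k <= p)%nat -> Cmod (b (S m) k) <= B) ->
  jacobian F (RtoC 0) = Cmod (a 1%nat 1%nat) ^ 2 - Cmod (b 1%nat 1%nat) ^ 2.
Proof.
intros Hp HE Ha Hb.
assert (D0 : disk 1 (RtoC 0)) by (unfold disk; rewrite Cmod_0; lra).
destruct (wirtinger_d _ _ _ _ (wirtinger_expansion p F a b h g B _ HE Ha Hb D0)) as [E1 E2].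
unfold jacobian. rewrite E1, E2. clear E1 E2.
assert (Hsum : forall (w : nat -> C) (d : nat -> C), w 1%nat = RtoC 0 ->
  (sum_n_m (fun k => w k * RtoC 0 + RtoC (Cmod (RtoC 0) ^ (2 * (k - 1))) * d k)%C 1 p : C)
  = d 1%nat).
{ intros w d Hw.
  replace p with (S (p - 1)) by lia. induction (p - 1)%nat as [|q IH].
  - rewrite Csum_S, Csum_0, Cmod_0. simpl. ring.
  - rewrite Csum_S, IH, Cmod_0, pow_i by lia. ring. }
assert (E0 : Cconj (RtoC 0) = RtoC 0) by apply Cconj_RtoC.
rewrite E0.
rewrite !Hsum by (simpl; rewrite Rmult_0_l; ring).
rewrite Cmod_conj.
rewrite (power_series_derivative_0 (coefficients a 1) B) by (intros; apply Ha; lia).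
rewrite (power_series_derivative_0 (coefficients b 1) B) by (intros; apply Hb; lia).
reflexivity.
Qed.

Lemma L_summand_series (a b : nat -> nat -> C) (k : nat) (B : R) (z : C) :
  (forall m, Cmod (a (S m) k) <= B) -> (forall m, Cmod (b (S m) k) <= B) ->
  disk 1 z ->
  is_series (harmonic_term (fun m => RtoC (INR (S m)) * a (S m) k)%C
    (fun m => - (RtoC (INR (S m)) * b (S m) k))%C z) (L_summand a b k z).
Proof.
intros Ha Hb Hz.
pose proof (is_series_Cmult z _ _ (is_series_derivative (coefficients a k) B z Ha Hz)) as H1.
pose proof (is_series_Cmult z _ _ (is_series_derivative (coefficients b k) B z Hb Hz)) as H2.
pose proof (is_series_Cminus _ _ _ _ H1 (is_series_Cconj _ _ H2)) as H.
eapply is_series_ext; [|exact H]. intros m. unfold harmonic_term, coefficients.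
cbv beta. rewrite !Cmult_conj, !Copp_conj, !Cmult_conj, !Cpow_S, !Cmult_conj. 
match goal with |- ?x = ?y => change (@eq C x y) end. ring.
Qed.

(** * The perturbation of the linear part *)

(** The linear part is taken out of the summand k = 1, the only one that has one. *)
Definition nonlinear_part (p : nat) (a b : nat -> nat -> C) (z : C) : C :=
  ((L_summand a b 1 z - (a 1%nat 1%nat * z - Cconj (b 1%nat 1%nat * z)))
   + sum_n_m (fun k => RtoC (Cmod z ^ (2 * (k - 1))) * L_summand a b k z) 2 p)%C.

(** Each summand is estimated termwise; for k = 1 the weight of the linear term is
    zero, which accounts for the - 1 in the majorants. *)
Lemma nonlinear_part_bounds (p : nat) (a b : nat -> nat -> C) (kap : R) :
  (1 <= p)%nat -> 0 <= kap ->
  (forall k m, (1 <= k <= p)%nat -> (k, m) <> (1%nat, 0%nat) ->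
     Cmod (a (S m) k) + Cmod (b (S m) k) <= kap) ->
  forall r, 0 <= r < 1 ->
  (forall z w, Cmod z <= r -> Cmod w <= r ->
     Cmod (nonlinear_part p a b z - nonlinear_part p a b w)
     <= kap * lipschitz_majorant p r * Cmod (z - w)) /\
  (forall z, Cmod z <= r ->
     Cmod (nonlinear_part p a b z) <= kap * size_majorant p r * Cmod z).
Proof.
intros Hp Hk Hab r Hr.
(* any common bound of all coefficients will do for convergence *)
set (B := kap + (Cmod (a 1%nat 1%nat) + Cmod (b 1%nat 1%nat))).
assert (HB : forall k m, (1 <= k <= p)%nat -> Cmod (a (S m) k) + Cmod (b (S m) k) <= B).
{ intros k m Hkp. unfold B.
  pose proof (Cmod_ge_0 (a 1%nat 1%nat)). pose proof (Cmod_ge_0 (b 1%nat 1%nat)).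
  destruct (Nat.eq_dec k 1) as [->|Hk1].
  - destruct m as [|m]; [lra|]. pose proof (Hab 1%nat (S m) Hkp ltac:(congruence)). lra.
  - pose proof (Hab k m Hkp ltac:(congruence)). lra. }
set (al := fun k m => (RtoC (INR (S m)) * a (S m) k)%C).
set (be := fun k m => (- (RtoC (INR (S m)) * b (S m) k))%C).
assert (Hser : forall k z, (1 <= k <= p)%nat -> disk 1 z ->
  is_series (harmonic_term (al k) (be k) z) (L_summand a b k z)).
{ intros k z Hkp Hz. apply L_summand_series with B; [| |exact Hz]; intros m;
    pose proof (HB k m Hkp); pose proof (Cmod_ge_0 (a (S m) k));
    pose proof (Cmod_ge_0 (b (S m) k)); lra. }
assert (Hcoef : forall k m, Cmod (al k m) + Cmod (be k m)
  = INR (S m) * (Cmod (a (S m) k) + Cmod (b (S m) k))).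
{ intros k m. unfold al, be. rewrite Cmod_opp, !Cmod_mult, Cmod_R.
  rewrite Rabs_pos_eq by apply pos_INR. ring. }
set (cut := fun (c : nat -> C) m => match m with O => RtoC 0 | S _ => c m end).
set (V1 := fun z => (L_summand a b 1 z - (a 1%nat 1%nat * z - Cconj (b 1%nat 1%nat * z)))%C).
assert (Hser1 : forall z, disk 1 z ->
  is_series (harmonic_term (cut (al 1%nat)) (cut (be 1%nat)) z) (V1 z)).
{ intros z Hz.
  pose proof (is_series_drop_first _ _ (Hser 1%nat z ltac:(lia) Hz)) as H.
  replace (V1 z) with (L_summand a b 1 z - harmonic_term (al 1%nat) (be 1%nat) z 0)%C.
  2:{ unfold V1, harmonic_term, al, be. simpl INR. rewrite Cpow_1_r.
      rewrite !Cmult_conj, Copp_conj, Cmult_conj, Cconj_RtoC. ring. }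
  eapply is_series_ext; [|exact H]. intros [|m]; [|reflexivity].
  unfold harmonic_term. simpl cut. rewrite !Cmult_0_l, Cconj_RtoC.
  match goal with |- ?x = ?y => change (@eq C x y) end. ring. }
set (wt := fun m : nat => match m with O => 0 | S _ => kap end).
assert (Hwt : forall m, wt m <= kap) by (intros [|m]; simpl; lra).
assert (Hcoef1 : forall m,
  Cmod (cut (al 1%nat) m) + Cmod (cut (be 1%nat) m) <= INR (S m) * wt m).
{ intros [|m]; [simpl; rewrite Cmod_0; lra|]. unfold cut, wt. rewrite Hcoef.
  apply Rmult_le_compat_l; [apply pos_INR|]. apply Hab; [lia | congruence]. }
assert (Hcoefk : forall k m, (2 <= k <= p)%nat ->
  Cmod (al k m) + Cmod (be k m) <= INR (S m) * kap).
{ intros k m Hkp. rewrite Hcoef.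
  apply Rmult_le_compat_l; [apply pos_INR|]. apply Hab; [lia | intros E; injection E; lia]. }
assert (Hw1 : forall n j m, 0 <= INR (S m) ^ n * r ^ (2 * j + m)).
{ intros. apply Rmult_le_pos; apply pow_le; [apply pos_INR | lra]. }
assert (Hone : forall z : C, RtoC (Cmod z ^ (2 * 0)) = RtoC 1) by (intros; reflexivity).
split.
- intros z w Hz Hw.
  assert (Dz : disk 1 z) by (unfold disk; lra). assert (Dw : disk 1 w) by (unfold disk; lra).
  rewrite lipschitz_majorant_eq by (lia || lra).
  unfold nonlinear_part. fold (V1 z) (V1 w).
  set (f := fun z k => (RtoC (Cmod z ^ (2 * (k - 1))) * L_summand a b k z)%C).
  change (Cmod (V1 z + sum_n_m (f z) 2 p - (V1 w + sum_n_m (f w) 2 p))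
    <= kap * ((1 + r) / (1 - r) ^ 3 - 1 + sum_n_m (fun k => r ^ (2 * (k - 1))
        * (2 * INR (k - 1) * (1 / (1 - r) ^ 2) + (1 + r) / (1 - r) ^ 3)) 2 p)
      * Cmod (z - w)).
  replace (V1 z + sum_n_m (f z) 2 p - (V1 w + sum_n_m (f w) 2 p))%C
    with ((V1 z - V1 w) + sum_n_m (fun k => f z k - f w k)%C 2 p)%C
    by (rewrite Csum_minus; ring).
  eapply Rle_trans; [apply Cmod_triangle|].
  rewrite Rmult_plus_distr_l, Rmult_plus_distr_r. apply Rplus_le_compat.
  + pose proof (harmonic_lipschitz _ _ wt (V1 z) (V1 w) z w 0 r
      (kap * ((1 + r) / (1 - r) ^ 3 - 1)) (Hser1 z Dz) (Hser1 w Dw) Hcoef1 Hz Hw) as H.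
    rewrite !Hone, !Cmult_1_l in H. apply H. intros N.
    rewrite (sum_n_Rext _ (fun m => wt m * (INR (S m) ^ 2 * r ^ m)))
      by (intros m; simpl (INR 0); simpl (2 * 0 + m)%nat; ring).
    replace ((1 + r) / (1 - r) ^ 3 - 1)
      with ((1 + r) / (1 - r) ^ 3 - INR 1 ^ 2 * r ^ 0) by (simpl; lra).
    apply (sum_n_weight_tail_le wt (fun m => INR (S m) ^ 2 * r ^ m)); auto.
    * intros m. exact (Hw1 2%nat 0%nat m).
    * intros N'. now apply sum_n_sqr_succ_geom_le.
  + rewrite <- Rsum_mult_l, Rmult_comm, <- Rsum_mult_l. apply Csum_Cmod_le. intros k Hkp.
    set (j := (k - 1)%nat).
    set (E := r ^ (2 * j) * (2 * INR j * (1 / (1 - r) ^ 2) + (1 + r) / (1 - r) ^ 3)).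
    rewrite Rmult_comm.
    apply (harmonic_lipschitz (al k) (be k) (fun _ => kap) _ _ z w j r (kap * E));
      [apply Hser; [lia | exact Dz] | apply Hser; [lia | exact Dw]
      | intros m; apply Hcoefk; lia | exact Hz | exact Hw |].
    intros N. apply sum_n_weight_le with (b := fun _ => kap);
      [intros _; lra | exact Hk | |].
    * intros m. apply Rmult_le_pos; [|apply pow_le; lra].
      pose proof (pos_INR j). pose proof (pos_INR (S m)).
      apply Rmult_le_pos; lra.
    * intros N'.
      rewrite (sum_n_Rext _ (fun m => r ^ (2 * j) * (2 * INR j * (INR (S m) * r ^ m)
        + INR (S m) ^ 2 * r ^ m))) by (intros m; rewrite pow_add; ring).
      rewrite sum_n_Rmult_l, sum_n_Rplus, sum_n_Rmult_l.
      apply Rmult_le_compat_l; [apply pow_le; lra|].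
      apply Rplus_le_compat; [|now apply sum_n_sqr_succ_geom_le].
      apply Rmult_le_compat_l; [pose proof (pos_INR j); lra|].
      now apply sum_n_succ_geom_le.
- intros z Hz. assert (Dz : disk 1 z) by (unfold disk; lra).
  unfold nonlinear_part, size_majorant. fold (V1 z).
  rewrite leading_majorant_eq by lra.
  eapply Rle_trans; [apply Cmod_triangle|].
  rewrite Rmult_plus_distr_l, Rmult_plus_distr_r. apply Rplus_le_compat.
  + pose proof (harmonic_size _ _ wt (V1 z) z 0 r
      (kap * (1 / (1 - r) ^ 2 - 1)) (Hser1 z Dz) Hcoef1 Hz) as H.
    rewrite !Hone, !Cmult_1_l in H. apply H. intros N.
    replace (1 / (1 - r) ^ 2 - 1) with (1 / (1 - r) ^ 2 - INR 1 * r ^ (2 * 0 + 0))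
      by (change (2 * 0 + 0)%nat with 0%nat; simpl (INR 1); simpl (r ^ 0); lra).
    apply (sum_n_weight_tail_le wt (fun m => INR (S m) * r ^ (2 * 0 + m))); auto.
    * intros m. rewrite <- (pow_1 (INR (S m))). apply Hw1.
    * intros N'. now apply sum_n_succ_geom_le.
  + rewrite <- Rsum_mult_l, Rmult_comm, <- Rsum_mult_l. apply Csum_Cmod_le. intros k Hkp.
    set (j := (k - 1)%nat). rewrite Rmult_comm.
    apply (harmonic_size (al k) (be k) (fun _ => kap) _ z j r);
      [apply Hser; [lia | exact Dz] | intros m; apply Hcoefk; lia | exact Hz |].
    intros N. apply sum_n_weight_le with (b := fun _ => kap);
      [intros _; lra | exact Hk | |].
    * intros m. rewrite <- (pow_1 (INR (S m))). apply Hw1.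
    * intros N'.
      rewrite (sum_n_Rext _ (fun m => r ^ (2 * j) * (INR (S m) * r ^ m)))
        by (intros m; rewrite pow_add; ring).
      rewrite sum_n_Rmult_l. replace (r ^ (2 * j) / (1 - r) ^ 2)
        with (r ^ (2 * j) * (1 / (1 - r) ^ 2)) by (field; lra).
      apply Rmult_le_compat_l; [apply pow_le; lra|]. now apply sum_n_succ_geom_le.
Qed.

(** * The main result *)

Lemma acute_of_Carg (p : nat) (a : nat -> nat -> C) :
  (forall n k1 k2 : nat,
     (1 <= n)%nat -> (1 <= k1 <= p)%nat -> (1 <= k2 <= p)%nat ->
     a n k1 <> 0%C -> a n k2 <> 0%C ->
     Rabs (Carg (a n k1 / a n k2)%C) <= PI / 2) ->
  acute_coefficients p a.
Proof.
intros H n k l Hn Hk Hl.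
destruct (classic (a n k = RtoC 0)) as [E|Ek]; [rewrite E; simpl; lra|].
destruct (classic (a n l = RtoC 0)) as [E|El]; [rewrite E; simpl; lra|].
now apply Carg_acute, H.
Qed.

Lemma coefficient_le (p : nat) (F : C -> C) (a b : nat -> nat -> C)
    (h g : nat -> C -> C) (M : R) (k m : nat) : 0 <= M ->
  polyharmonic_expansion p F (RtoC 0) a b h g ->
  acute_coefficients p a -> acute_coefficients p b ->
  (forall z, disk 1 z -> Cmod (F z) <= M) ->
  (1 <= k <= p)%nat -> Cmod (a (S m) k) <= M /\ Cmod (b (S m) k) <= M.
Proof.
intros HM HE Ha Hb HF Hk.
pose proof (coefficient_inequality p F a b h g M (S m) HE Ha Hb HF) as H.
set (f := fun n k => Cmod (a n k) ^ 2 + Cmod (b n k) ^ 2).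
assert (Hf : forall n k, 0 <= f n k).
{ intros. unfold f. pose proof (pow2_ge_0 (Cmod (a n k0))).
  pose proof (pow2_ge_0 (Cmod (b n k0))). lra. }
pose proof (Rsum_ge_term (fun n => sum_n_m (f n) 1 p) 1 (S m) (S m)
  (fun n _ => Rsum_nonneg (f n) 1 p (fun k _ => Hf n k)) ltac:(lia)) as H1.
pose proof (Rsum_ge_term (f (S m)) 1 p k (fun k _ => Hf (S m) k) Hk) as H2.
assert (H3 : f (S m) k <= M ^ 2) by (eapply Rle_trans; [exact H2|]; eapply Rle_trans; [exact H1 | exact H]).
unfold f in H3.
pose proof (pow2_ge_0 (Cmod (a (S m) k))). pose proof (pow2_ge_0 (Cmod (b (S m) k))).
split; (apply Rsqr_incr_0_var; [unfold Rsqr; nra | exact HM]).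
Qed.

(** The square sum is kept together with that of the linear coefficients, which
    the Jacobian condition bounds from below. *)
Lemma coefficient_pair_le (p : nat) (F : C -> C) (a b : nat -> nat -> C)
    (h g : nat -> C -> C) (M : R) (k m : nat) :
  polyharmonic_expansion p F (RtoC 0) a b h g ->
  acute_coefficients p a -> acute_coefficients p b ->
  (forall z, disk 1 z -> Cmod (F z) <= M) ->
  (1 <= k <= p)%nat -> (k, m) <> (1%nat, 0%nat) ->
  (Cmod (a 1%nat 1%nat) ^ 2 + Cmod (b 1%nat 1%nat) ^ 2)
  + (Cmod (a (S m) k) ^ 2 + Cmod (b (S m) k) ^ 2) <= M ^ 2.
Proof.
intros HE Ha Hb HF Hk Hkm.
pose proof (coefficient_inequality p F a b h g M (S m) HE Ha Hb HF) as H.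
set (f := fun n k => Cmod (a n k) ^ 2 + Cmod (b n k) ^ 2).
assert (Hf : forall n k, 0 <= f n k).
{ intros. unfold f. pose proof (pow2_ge_0 (Cmod (a n k0))).
  pose proof (pow2_ge_0 (Cmod (b n k0))). lra. }
assert (Hs : forall n, 0 <= sum_n_m (f n) 1 p)
  by (intros; apply Rsum_nonneg; intros; apply Hf).
eapply Rle_trans; [|exact H].
change (f 1%nat 1%nat + f (S m) k <= sum_n_m (fun n => sum_n_m (f n) 1 p) 1 (S m)).
destruct m as [|m].
- eapply Rle_trans; [|apply (Rsum_ge_term (fun n => sum_n_m (f n) 1 p) 1 1 1); [intros; apply Hs | lia]].
  apply Rsum_ge_two_terms; [intros; apply Hf|].
  destruct (Nat.eq_dec k 1) as [->|]; [congruence | lia].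
- eapply Rle_trans;
    [|apply (Rsum_ge_two_terms (fun n => sum_n_m (f n) 1 p) (S (S m)) (S (S m)));
      [intros; apply Hs | lia]].
  apply Rplus_le_compat; apply Rsum_ge_term; try (intros; apply Hf); lia.
Qed.

Theorem theorem3 :
  forall (p : nat) (F : C -> C) (a0 : C) (a b : nat -> nat -> C)
         (h g : nat -> C -> C),
    (1 <= p)%nat ->
    polyharmonic p (disk 1) F ->
    (forall (k : nat) (z : C), (1 <= k <= p)%nat -> disk 1 z ->
       is_series (fun m : nat => (a (S m) k * z ^ S m)%C) (h k z)) ->
    (forall (k : nat) (z : C), (1 <= k <= p)%nat -> disk 1 z ->
       is_series (fun m : nat => (b (S m) k * z ^ S m)%C) (g k z)) ->
    (forall z : C, disk 1 z ->
       F z = (a0 + sum_n_m (fun k : nat =>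
                     RtoC (Cmod z ^ (2 * (k - 1))) *
                     (h k z + Cconj (g k z))) 1 p)%C) ->
    (forall n k1 k2 : nat,
       (1 <= n)%nat -> (1 <= k1 <= p)%nat -> (1 <= k2 <= p)%nat ->
       a n k1 <> 0%C -> a n k2 <> 0%C ->
       Rabs (Carg (a n k1 / a n k2)%C) <= PI / 2) ->
    (forall n k3 k4 : nat,
       (1 <= n)%nat -> (1 <= k3 <= p)%nat -> (1 <= k4 <= p)%nat ->
       b n k3 <> 0%C -> b n k4 <> 0%C ->
       Rabs (Carg (b n k3 / b n k4)%C) <= PI / 2) ->
    F 0%C = 0%C ->
    Rabs (jacobian F 0%C) - 1 = 0 ->
    (forall M : R, 1 < M ->
       (forall z : C, disk 1 z -> Cmod (F z) <= M) ->
       exists r6 : R,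
         least_positive_root (r6_fun M p) r6 /\ r6 < 1 /\
         univalent_on (disk r6) (L_op F) /\
         contains_univalent_disk (L_op F) r6 (rho6_val M p r6))
    /\
    ((forall z : C, disk 1 z -> Cmod (F z) <= 1) ->
       univalent_on (disk 1) (L_op F) /\
       maps_onto (L_op F) (disk 1) (disk 1)).
Proof.
intros p F a0 a b h g Hp _ Hh Hg HF Harg_a Harg_b HF0 HJ.
pose proof (acute_of_Carg p a Harg_a) as Ha.
pose proof (acute_of_Carg p b Harg_b) as Hb.
assert (HE : polyharmonic_expansion p F (RtoC 0) a b h g).
{ assert (HE0 : polyharmonic_expansion p F a0 a b h g) by (split; [|split]; assumption).
  pose proof (expansion_constant _ _ _ _ _ _ _ HE0) as E.
  rewrite HF0 in E. now rewrite <- E in HE0. }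
set (al := a 1%nat 1%nat). set (be := (- Cconj (b 1%nat 1%nat))%C).
set (lam := Rabs (Cmod al - Cmod be)).
assert (Ebe : Cmod be = Cmod (b 1%nat 1%nat)) by (unfold be; now rewrite Cmod_opp, Cmod_conj).
(* valid for M = 1 as well, where K = 0 and the nonlinear part vanishes *)
assert (Hmain : forall M, 1 <= M -> (forall z, disk 1 z -> Cmod (F z) <= M) ->
  let K := sqrt (M ^ 4 - 1) in
  Rabs (Cmod al ^ 2 - Cmod be ^ 2) = 1 /\
  Cmod al ^ 2 + Cmod be ^ 2 <= M ^ 2 /\
  (forall z, disk 1 z ->
     L_op F z = (al * z + be * Cconj z + nonlinear_part p a b z)%C) /\
  (forall r, 0 <= r < 1 ->
    (forall z w, Cmod z <= r -> Cmod w <= r ->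
       Cmod (nonlinear_part p a b z - nonlinear_part p a b w)
       <= K * lam * lipschitz_majorant p r * Cmod (z - w)) /\
    (forall z, Cmod z <= r ->
       Cmod (nonlinear_part p a b z) <= K * lam * size_majorant p r * Cmod z))).
{ intros M HM HFM K.
  assert (HaM : forall k m, (1 <= k <= p)%nat -> Cmod (a (S m) k) <= M).
  { intros k m Hk. apply (coefficient_le p F a b h g M k m); auto; lra. }
  assert (HbM : forall k m, (1 <= k <= p)%nat -> Cmod (b (S m) k) <= M).
  { intros k m Hk. apply (coefficient_le p F a b h g M k m); auto; lra. }
  assert (HJ1 : Rabs (Cmod al ^ 2 - Cmod be ^ 2) = 1).
  { rewrite Ebe. unfold al.
    rewrite <- (jacobian_expansion p F a b h g M Hp HE HaM HbM).
    lra. }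
  split; [exact HJ1|]. split; [|split].
  - rewrite Ebe. pose proof (coefficient_pair_le p F a b h g M 1 1 HE Ha Hb HFM
      ltac:(lia) ltac:(congruence)) as H.
    pose proof (pow2_ge_0 (Cmod (a 2%nat 1%nat))). pose proof (pow2_ge_0 (Cmod (b 2%nat 1%nat))).
    unfold al. lra.
  - intros z Hz. rewrite (L_op_expansion p F a b h g M z HE HaM HbM Hz).
    rewrite (sum_Sn_m _ 1 p) by exact Hp.
    unfold nonlinear_part, al, be. rewrite Cmult_conj.
    match goal with |- plus ?x ?y = _ => change (@eq C (x + y)%C
      (a 1%nat 1%nat * z + - Cconj (b 1%nat 1%nat) * Cconj z
       + (L_summand a b 1 z - (a 1%nat 1%nat * z - Cconj (b 1%nat 1%nat) * Cconj z) + y))%C) end.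
    simpl (2 * (1 - 1))%nat. simpl (Cmod z ^ 0). ring.
  - intros r Hr. apply nonlinear_part_bounds; [exact Hp| | |exact Hr].
    + apply Rmult_le_pos; [apply sqrt_pos | apply Rabs_pos].
    + intros k m Hk Hkm. apply coefficient_le_lambda; try apply Cmod_ge_0; try assumption.
      rewrite Ebe. now apply (coefficient_pair_le p F a b h g M k m). }
split.
- intros M HM HFM.
  destruct (Hmain M ltac:(lra) HFM) as (HJ1 & HS & HL & HP). clear Hmain.
  pose proof (dilatation_product _ _ (Cmod_ge_0 al) (Cmod_ge_0 be) HJ1) as Hprod.
  fold lam in Hprod.
  assert (Hlam0 : 0 <= lam) by apply Rabs_pos.
  assert (Hlam : 0 < lam) by (destruct (Req_dec lam 0) as [E|]; [rewrite E in Hprod; lra | lra]).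
  assert (Hl0 : lambda0 M <= lam).
  { apply lambda0_le; try apply Cmod_ge_0; try assumption; lra. }
  set (K := sqrt (M ^ 4 - 1)) in *.
  assert (HK : 0 < K).
  { apply sqrt_lt_R0. replace (M ^ 4 - 1) with ((M ^ 2 - 1) * (M ^ 2 + 1)) by ring.
    apply Rmult_lt_0_compat; nra. }
  destruct (r6_exists M p HM) as [r6 [Hroot Hr6]].
  exists r6. split; [exact Hroot|]. split; [exact Hr6|].
  destruct Hroot as [(Hr0 & _ & Er) _].
  assert (Er' : K * lipschitz_majorant p r6 = 1).
  { change (1 - K * lipschitz_majorant p r6 = 0) in Er. lra. }
  set (s := K * size_majorant p r6).
  assert (Hs0 : 0 <= s).
  { apply Rmult_le_pos; [lra|]. apply (size_majorant_mono p r6 r6); lra. }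
  assert (Hs1 : s < 1).
  { rewrite <- Er'. apply Rmult_lt_compat_l; [exact HK|].
    now apply size_lt_lipschitz_majorant. }
  assert (Hrho : rho6_val M p r6 = lambda0 M * r6 * (1 - s)).
  { unfold rho6_val, s, size_majorant. fold K. ring. }
  assert (Hlpos : 0 < lambda0 M).
  { unfold lambda0. apply Rdiv_lt_0_compat; [apply sqrt_lt_R0; lra|].
    pose proof (sqrt_pos (M ^ 2 - 1)).
    assert (0 < sqrt (M ^ 2 + 1)) by (apply sqrt_lt_R0; nra). lra. }
  apply (perturbation_contains_disk (L_op F) (nonlinear_part p a b) al be lam r6 s);
    [reflexivity | exact Hlam | exact Hr0 | | | lra | | ].
  + intros z Hz. apply HL. unfold disk in *. lra.
  + intros r Hr. exists (K * lipschitz_majorant p r). split.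
    * split.
      -- apply Rmult_le_pos; [lra|].
         eapply Rle_trans; [|apply lipschitz_majorant_ge; lra].
         pose proof (pow_div_le 0 r 0 2 ltac:(lra) ltac:(lra)) as H.
         simpl (_ ^ 0) in H. replace (1 / (1 - 0) ^ 2) with 1 in H by field. lra.
      -- rewrite <- Er'. apply Rmult_lt_compat_l; [exact HK|].
         apply lipschitz_majorant_increasing; lra.
    * intros z w Hz Hw.
      replace (lam * (K * lipschitz_majorant p r)) with (K * lam * lipschitz_majorant p r) by ring.
      apply (HP r); [lra | exact Hz | exact Hw].
  + intros z Hz. unfold s.
    replace (lam * (K * size_majorant p r6)) with (K * lam * size_majorant p r6) by ring.
    apply (HP r6); [lra|]. unfold disk in Hz. lra.
  + rewrite Hrho. split.
    * apply Rmult_lt_0_compat; [apply Rmult_lt_0_compat; assumption | lra].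
    * apply Rmult_le_compat_r; [lra|]. apply Rmult_le_compat_r; [lra | exact Hl0].
- intros HF1.
  destruct (Hmain 1 ltac:(lra) HF1) as (HJ1 & HS & HL & HP). clear Hmain.
  replace (sqrt (1 ^ 4 - 1)) with 0 in HP
    by (replace (1 ^ 4 - 1) with 0 by ring; now rewrite sqrt_0).
  assert (Hlin : forall z, disk 1 z -> L_op F z = (al * z + be * Cconj z)%C).
  { intros z Hz. rewrite HL by exact Hz.
    destruct (HP (Cmod z)) as [_ H]; [split; [apply Cmod_ge_0 | exact Hz]|].
    specialize (H z (Rle_refl _)). rewrite !Rmult_0_l in H.
    replace (nonlinear_part p a b z) with (RtoC 0); [ring|].
    symmetry. apply Cmod_eq_0. apply Rle_antisym; [exact H | apply Cmod_ge_0]. }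
  pose proof (dilatation_product _ _ (Cmod_ge_0 al) (Cmod_ge_0 be) HJ1) as Hprod.
  pose proof (dilatation_squares (Cmod al) (Cmod be)) as Hsq.
  fold lam in Hprod, Hsq.
  (* lam and its inverse have sum of squares at most 2, so they coincide *)
  assert (Heq : lam = Cmod al + Cmod be).
  { pose proof (pow2_ge_0 (lam - (Cmod al + Cmod be))) as H. nra. }
  assert (Hlam : lam = 1).
  { rewrite <- Heq in Hprod. assert (0 <= lam) by apply Rabs_pos. nra. }
  assert (Hiso : forall z, Cmod (al * z + be * Cconj z) = Cmod z).
  { intros z. apply Rle_antisym.
    - eapply Rle_trans; [apply Cmod_triangle|]. rewrite !Cmod_mult, Cmod_conj.
      rewrite <- Rmult_plus_distr_r, <- Heq, Hlam. lra.
    - pose proof (real_linear_lower al be z) as H. fold lam in H.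
      rewrite Hlam in H. lra. }
  split.
  + intros z w Hz Hw E. rewrite !Hlin in E by assumption.
    apply Cminus_eq_0. rewrite <- Hiso.
    replace (al * (z - w) + be * Cconj (z - w))%C
      with (al * z + be * Cconj z - (al * w + be * Cconj w))%C
      by (rewrite Cminus_conj; ring).
    rewrite E. replace (_ - _)%C with (RtoC 0) by ring. rewrite Cmod_0. lra.
  + intros w. split.
    * intros Hw. destruct (real_linear_surj al be w) as [z Hz].
      { intros E. unfold lam in Hlam. rewrite E in Hlam.
        replace (Cmod be - Cmod be) with 0 in Hlam by ring. rewrite Rabs_R0 in Hlam. lra. }
      exists z.
      assert (Dz : disk 1 z) by (unfold disk in *; now rewrite <- Hiso, Hz).
      split; [exact Dz | now rewrite Hlin].
    * intros [z [Hz <-]]. rewrite Hlin by exact Hz. unfold disk in *. now rewrite Hiso.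
Qed.
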